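(* Let $k,k_P,k_Q$ be integers with $k\ge 3$ and $1\le k_P<k_Q<k$. Let $a\in C_c^\infty(\mathbb R^3)$ be supported in $[-1,1]^3$, and for $\lambda>0$ let $$T_\lambda f(x,y)=\int_{\mathbb R} e^{i\lambda \Phi(x,y,t)}\,a(x,y,t)\,f(t)\,dt,\qquad \Phi(x,y,t)=x^{k-k_P}t^{k_P}+y^{k-k_Q}t^{k_Q}.$$ Then there exists a constant $C>0$ such that, for all sufficiently large $\lambda$, $$\|T_\lambda\|_{L^2(\mathbb R)\to L^2(\mathbb R^2)}\le C\,\lambda^{-\rho_*}(\log\lambda)^{\gamma},$$ where $\rho_*=\min\{\rho_1,\rho_2,\rho_3\}$ and $\gamma\in\{0,1\}$ is given by $$\gamma=\begin{cases}1,&\text{if } k=2k_P,\\ 1,&\text{if } k\ne 2k_P,\ \rho_*=\rho_1,\ \text{and } 1=\frac{k_P}{k-k_P}+\frac{k_Q}{k-k_Q},\\ 0,&\text{otherwise.}\end{cases}$$ Here $\rho_1,\rho_2,\rho_3$ are the exponents defined in the context.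
   Context: For integers $k\ge3$, $1\le k_P<k_Q<k$, define $$\rho_1=\frac1{2(k-k_P)}+\frac1{2(k-k_Q)},\qquad \rho_2=\frac1{2(k-k_P)}+\frac1{2k_Q}\Bigl(1-\frac{k_P}{k-k_P}\Bigr)=\frac{k_Q+k-2k_P}{2k_Q(k-k_P)},\qquad \rho_3=\frac1{2k_P}.$$ $\|\cdot\|_{L^2(\mathbb R)\to L^2(\mathbb R^2)}$ denotes the operator norm. The constant $C$ is independent of $\lambda$ (it may depend on $k,k_P,k_Q$ and $a$). Logarithms are natural. *)

(* Defs.v *)
From HB Require Import structures.
From mathcomp Require Import all_boot all_order all_algebra.
From mathcomp Require Import complex.
From mathcomp Require Import all_classical all_reals all_analysis.
Set Implicit Arguments.
Unset Strict Implicit.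
Unset Printing Implicit Defensive.
Import Order.TTheory GRing.Theory Num.Theory.
Import numFieldNormedType.Exports.
Local Open Scope classical_set_scope.
Local Open Scope ring_scope.
Local Open Scope complex_scope.

Section Smooth.
Context {R : realType}.

Definition axes : seq (R * R * R) := [:: (1, 0, 0); (0, 1, 0); (0, 0, 1)].

(* Existence and continuity of all partial derivatives of order at most n. *)
Fixpoint classC (n : nat) (g : R * R * R -> R) : Prop :=
  continuous g /\
  if n is m.+1 then
    forall v, v \in axes ->
      (forall p, derivable g p v) /\ classC m (fun p => 'D_v g p)
  else True.

Definition smooth (g : R * R * R -> R) : Prop := forall n, classC n g.

Definition supp (a : R * R * R -> R[i]) : set (R * R * R) :=
  closure [set p | a p != 0].

(* Smoothness of a complex-valued function is smoothness of its real and
   imaginary parts. *)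
Definition test_function (a : R * R * R -> R[i]) : Prop :=
  [/\ smooth (fun p => complex.Re (a p)),
      smooth (fun p => complex.Im (a p)) &
      compact (supp a)].

End Smooth.

Section ComplexL2.
Context {d : measure_display} {T : measurableType d} {R : realType}.
Variable mu : {measure set T -> \bar R}.

Definition cintegral (f : T -> R[i]) : R[i] :=
  Rintegral mu setT (fun x => complex.Re (f x)) +i*
  Rintegral mu setT (fun x => complex.Im (f x)).

Definition L2norm (f : T -> R[i]) : \bar R :=
  Lnorm mu 2%:E (fun x => (Normc.normc (f x))%:E).

(* Functions rather than almost-everywhere classes: the L2 norm and integral
   operators do not depend on the representative. *)
Definition L2 : set (T -> R[i]) :=
  [set f | [/\ measurable_fun setT (fun x => complex.Re (f x)),
               measurable_fun setT (fun x => complex.Im (f x)) &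
               (L2norm f < +oo)%E]].

End ComplexL2.

Definition opnorm {d1 d2 : measure_display} {T1 : measurableType d1}
    {T2 : measurableType d2} {R : realType}
    (mu1 : {measure set T1 -> \bar R}) (mu2 : {measure set T2 -> \bar R})
    (A : (T1 -> R[i]) -> T2 -> R[i]) : \bar R :=
  ereal_sup [set L2norm mu2 (A f) |
             f in [set f | L2 mu1 f /\ (L2norm mu1 f <= 1)%E]].

Section Operator.
Context {R : realType}.

Definition cis (theta : R) : R[i] := cos theta +i* sin theta.

Definition Phi (k kP kQ : nat) (x y t : R) : R :=
  x ^+ (k - kP) * t ^+ kP + y ^+ (k - kQ) * t ^+ kQ.

Definition Tlam (k kP kQ : nat) (a : R * R * R -> R[i]) (lam : R)
    (f : R -> R[i]) (xy : R * R) : R[i] :=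
  cintegral (@lebesgue_measure R)
    (fun t : R => cis (lam * Phi k kP kQ xy.1 xy.2 t) * a (xy, t) * f t).

End Operator.

Section Exponents.
Variables (R : realType) (k kP kQ : nat).

Definition rho1 : R :=
  1 / (2 * (k%:R - kP%:R)) + 1 / (2 * (k%:R - kQ%:R)).

Definition rho2 : R :=
  1 / (2 * (k%:R - kP%:R)) +
  1 / (2 * kQ%:R) * (1 - kP%:R / (k%:R - kP%:R)).

Definition rho3 : R := 1 / (2 * kP%:R).

Definition rho_star : R := Num.min rho1 (Num.min rho2 rho3).

Definition log_power : nat :=
  if k == (2 * kP)%N then 1
  else if (rho_star == rho1) &&
          (1 == kP%:R / (k%:R - kP%:R) + kQ%:R / (k%:R - kQ%:R) :> R)
  then 1 else 0.

End Exponents.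

(* Main.v *)
From HB Require Import structures.
Require Import Defs.
From mathcomp Require Import all_boot all_order all_algebra.
From mathcomp Require Import complex.
From mathcomp Require Import all_classical all_reals all_analysis.
From mathcomp Require Import measurable_realfun ring lra.
Import Order.TTheory GRing.Theory Num.Theory.
Import numFieldNormedType.Exports.
Local Open Scope classical_set_scope.
Local Open Scope ring_scope.

(** Write p = kP, q = kQ.  The real and imaginary parts of the kernel are sums
    of kernels [cos(lam t^p x^(k-p) + f1) cos(lam t^q y^(k-q) + f2) b(x, y, t)],
    and the T^*T kernel of each of these, the integral in (x, y) of the product
    of its values at s and t, is bounded after integrating by parts once in x
    and once in y by a constant times
      min(1, (lam | |s|^p - |t|^p |)^(-1/(k-p)))
      min(1, (lam | |s|^q - |t|^q |)^(-1/(k-q))),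
    because the primitive of cos(mu u^m + f) oscillates by at most
    C |mu|^(-1/m).  Since | |s|^p - |t|^p | >= | |s| - |t| |^p, Schur's test
    reduces the squared operator norm to the integral over [0, 2] of
      min(1, (lam u^p)^(-1/(k-p))) min(1, (lam u^q)^(-1/(k-q))).
    Splitting it at lam^(-1/p) and lam^(-1/q) gives the exponents 2 rho3,
    2 rho2 and 2 rho1, with a logarithm exactly when a power u^-1 occurs;
    in particular the argument even yields the square root of the logarithm. *)

Set Implicit Arguments.
Unset Strict Implicit.
Unset Printing Implicit Defensive.

(** * Measurability, Fubini and Schur's test *)

(** The phase separates: at fixed [s] and [t] the product of two waves is a function of [x] times a
    function of [y] times an amplitude, and only the amplitude couples the two variables. One
    integration by parts in each variable therefore leaves a single mixed derivative on the
    amplitude, and the two one-dimensional decays multiply; for the amplitude this calls for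
    derivatives up to order 2 only. The one-dimensional phase mu u^m + f has a degenerate critical
    point at 0, and its frequency mu vanishes when |s| = |t|. So the primitives must be controlled
    uniformly in the frequency and in [f]. This is done by monotonicity and the mean value theorem
    rather than by stationary phase. Real cosines produce the sum of the frequencies along with
    their difference, so the argument does not separate [s] from [-t]. That is why only | |s| - |t|
    | appears; in Schur's integral this costs a constant factor. *)

Lemma measurable_fun_caratheodory d (X : measurableType d) (R : realType)
    (f : X * R -> R) :
  (forall y, measurable_fun setT (fun x => f (x, y))) ->
  (forall x, continuous (fun y => f (x, y))) ->
  measurable_fun setT f.
Proof.
move=> mf cf.
(* [q n] rounds down to the grid of mesh 1/(n+1). With [q n y] in place of [y] the function is
   measurable cell by cell, and continuity in [y] recovers [f] in the limit. *)
pose q n (y : R) : R := (Num.floor (n.+1%:R * y))%:~R / n.+1%:R.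
have qy y : q n y @[n --> \oo] --> y.
  apply/cvgrPdist_le => e e0; near=> n.
  have n0 : (0 : R) < n.+1%:R by [].
  rewrite /q -[X in `|X - _|](mulfK (lt0r_neq0 n0)) -mulrBl normrM.
  rewrite (@ger0_norm _ n.+1%:R^-1)// ler_pdivrMr//.
  rewrite [y * _]mulrC ger0_norm ?subr_ge0 ?floor_le//.
  have := floorD1_gt (n.+1%:R * y); rewrite intrD => h.
  apply: (@le_trans _ _ 1); first by rewrite lerBlDr addrC ltW.
  rewrite mulrC -ler_pdivrMr// div1r.
  rewrite (le_trans _ (_ : n%:R <= n.+1%:R))// ?ler_nat//.
  by near: n; exact: nbhs_infty_ger.
apply: (@measurable_fun_cvg _ _ _ _ (fun n z => f (z.1, q n z.2))).
- move=> n _ /= B mB; rewrite setTI.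
  rewrite (_ : _ @^-1` _ = \bigcup_(k : int)
      (((fun x => f (x, k%:~R / n.+1%:R)) @^-1` B) `*`
       [set` `[k%:~R / n.+1%:R, (k + 1)%:~R / n.+1%:R[ ])).
    apply: countable_bigcupT_measurable => [|k]; first exact: countableP.
    apply: measurableX; last exact: measurable_itv.
    by rewrite -[X in measurable X]setTI; exact: mf.
  have fl (y : R) k : (k%:~R / n.+1%:R <= y < (k + 1)%:~R / n.+1%:R) =
                (Num.floor (n.+1%:R * y) == k).
    by rewrite floor_eq ler_pdivrMr// ltr_pdivlMr// mulrC.
  apply/seteqP; split => [[x y] /= Bf|[x y] [k _ [/= Bf]]].
    exists (Num.floor (n.+1%:R * y)) => //; split => //=.
    by rewrite in_itv/= fl.
  by rewrite in_itv/= fl => /eqP kE; move: Bf; rewrite -kE.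
- move=> [x y] _ /=.
  apply: (cvg_comp (fun n => q n y) (fun y => f (x, y)) (qy y)).
  exact: cf.
Unshelve. all: by end_near. Qed.

(** A product majorant makes every slice integrable, not only almost every one. All partial
    integrals are then genuine real numbers, and the exchange can be stated with real-valued
    integrals. *)
Lemma dominated_Fubini d1 d2 (X : measurableType d1) (Y : measurableType d2)
    (R : realType) (m1 : {sigma_finite_measure set X -> \bar R})
    (m2 : {sigma_finite_measure set Y -> \bar R}) (b : X -> R) (c : Y -> R)
    (q : X * Y -> R) :
  m1.-integrable setT (EFin \o b) -> m2.-integrable setT (EFin \o c) ->
  measurable_fun setT q -> (forall x y, `|q (x, y)| <= b x * c y) ->
  [/\ forall x, m2.-integrable setT (EFin \o (fun y => q (x, y))),
      forall y, m1.-integrable setT (EFin \o (fun x => q (x, y))),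
      m1.-integrable setT (EFin \o (fun x => \int[m2]_y q (x, y))),
      m2.-integrable setT (EFin \o (fun y => \int[m1]_x q (x, y))) &
      \int[m1]_x \int[m2]_y q (x, y) = \int[m2]_y \int[m1]_x q (x, y) /\
      \int[(m1 \x m2)%E]_z q z = \int[m1]_x \int[m2]_y q (x, y)].
Proof.
move=> ib ic mq qbc.
have i1 x : m2.-integrable setT (EFin \o (fun y => q (x, y))).
  apply: (@le_integrable _ _ _ _ _ _ _ (fun y => (b x)%:E * (c y)%:E)%E) => //.
  - by apply/measurable_EFinP; exact: measurableT_comp.
  - move=> y _; rewrite -EFinM lee_fin (le_trans (qbc _ _))// ler_norm//.
  - exact: integrableZl.
have i2 y : m1.-integrable setT (EFin \o (fun x => q (x, y))).
  apply: (@le_integrable _ _ _ _ _ _ _ (fun x => (c y)%:E * (b x)%:E)%E) => //.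
  - by apply/measurable_EFinP; exact: measurableT_comp.
  - by move=> x _; rewrite -EFinM lee_fin mulrC (le_trans (qbc _ _))// ler_norm.
  - exact: integrableZl.
have e1 x : (\int[m2]_y (q (x, y))%:E = (\int[m2]_y q (x, y))%:E)%E.
  by rewrite /Rintegral fineK//; exact: (integrable_fin_num measurableT (i1 x)).
have e2 y : (\int[m1]_x (q (x, y))%:E = (\int[m1]_x q (x, y))%:E)%E.
  by rewrite /Rintegral fineK//; exact: (integrable_fin_num measurableT (i2 y)).
(* The iterated integral of [|q|] is at most the integral of [|b|] times that of [|c|], which is
   finite. *)
have iq : (m1 \x m2)%E.-integrable setT (EFin \o q).
  apply/(integrable12ltyP _); first exact/measurable_EFinP.
  have ib' := integrable_abse ib.
  have ic' := integrable_abse ic.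
  have fc : (\int[m2]_y `|(EFin \o c) y|)%E \is a fin_num.
    exact: (integrable_fin_num measurableT ic').
  apply: (@le_lt_trans _ _ (\int[m1]_x (`|(EFin \o b) x| *
      (\int[m2]_y `|(EFin \o c) y|)))%E).
    apply: ge0_le_integral => //.
    - by move=> x _; exact: integral_ge0.
    - apply: (measurable_fun_fubini_tonelli_F (fun z => `|(EFin \o q) z|%E)) => //.
      by apply: measurableT_comp => //; exact/measurable_EFinP.
    - apply: emeasurable_funM; last exact: measurable_cst.
      exact: (measurable_int m1).
    - move=> x _; rewrite -ge0_integralZl//; last first.
        exact: (measurable_int m2).
      apply: ge0_le_integral => //.
      + by apply: measurableT_comp => //; apply/measurable_EFinP; exact: measurableT_comp.
      + apply: emeasurable_funM; first exact: measurable_cst.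
        exact: (measurable_int m2).
      + move=> y _ /=; rewrite lee_fin -normrM (le_trans (qbc _ _))// ler_norm//.
  rewrite -(fineK fc) ge0_integralZr//; last 2 first.
    - exact: (measurable_int m1).
    - by rewrite lee_fin fine_ge0// integral_ge0.
  have fb : (\int[m1]_x `|(EFin \o b) x|)%E \is a fin_num.
    exact: (integrable_fin_num measurableT ib').
  by rewrite -(fineK fb) -EFinM ltry.
have F1 := integrable_fubini_F iq.
have F2 : m2.-integrable setT (fubini_G m1 (EFin \o q)).
  apply/integrableP; split; first exact: measurable_fubini_G iq.
  apply: le_lt_trans ((integrable21ltyP _ _ _).1 iq); last first.
    by case/integrableP : iq.
  apply: ge0_le_integral => //.
  - apply: measurableT_comp => //; exact: measurable_fubini_G iq.
  - apply: (measurable_fun_fubini_tonelli_G (fun z => `|(EFin \o q) z|%E)) => //.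
    by apply: measurableT_comp => //; exact/measurable_EFinP.
  - move=> y _; apply: le_abse_integral => //.
    by apply/measurable_EFinP; exact: measurableT_comp.
have E1 : fubini_F m2 (EFin \o q) = EFin \o (fun x => \int[m2]_y q (x, y)).
  by apply/funext => x; rewrite /fubini_F /= e1.
have E2 : fubini_G m1 (EFin \o q) = EFin \o (fun y => \int[m1]_x q (x, y)).
  by apply/funext => x; rewrite /fubini_G /= e2.
split => //; rewrite -?E1 -?E2//; split.
  have := Fubini iq; rewrite -/(fubini_F m2 (EFin \o q)) -/(fubini_G m1 (EFin \o q)).
  by rewrite E1 E2 /= /Rintegral => ->.
have := integral12_prod_meas1 iq; rewrite E1 => h.
by rewrite /Rintegral -h.
Qed.

(** [A] bounds the square of the operator norm, which is what Schur's test delivers. Integrability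
    at every [x] and measurability of the image are included so that kernels can be added. *)
Definition L2_bounded d1 d2 (X : measurableType d1) (Y : measurableType d2)
    (R : realType) (m1 : {measure set X -> \bar R}) (m2 : {measure set Y -> \bar R})
    (k : X * Y -> R) (A : R) : Prop :=
  forall g : Y -> R, measurable_fun setT g ->
  (\int[m2]_t (g t ^+ 2)%:E < +oo)%E ->
  [/\ forall x, m2.-integrable setT (EFin \o (fun t => k (x, t) * g t)),
      measurable_fun setT (fun x => \int[m2]_t (k (x, t) * g t)) &
      (\int[m1]_x ((\int[m2]_t (k (x, t) * g t)) ^+ 2)%:E <=
       A%:E * \int[m2]_t (g t ^+ 2)%:E)%E].

(** From (u + v)^2 <= 2 u^2 + 2 v^2; the loss of a constant is harmless and Minkowski's inequality
    is avoided. *)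
Lemma L2_boundedD d1 d2 (X : measurableType d1) (Y : measurableType d2)
    (R : realType) (m1 : {measure set X -> \bar R}) (m2 : {measure set Y -> \bar R})
    (k1 k2 : X * Y -> R) (A1 A2 : R) :
  L2_bounded m1 m2 k1 A1 -> L2_bounded m1 m2 k2 A2 ->
  L2_bounded m1 m2 (fun z => k1 z + k2 z) (2 * (A1 + A2)).
Proof.
move=> b1 b2 g mg g2.
have [i1 mS1 l1] := b1 g mg g2; have [i2 mS2 l2] := b2 g mg g2.
set S1 := (fun x => \int[m2]_t (k1 (x, t) * g t)) in mS1 l1.
set S2 := (fun x => \int[m2]_t (k2 (x, t) * g t)) in mS2 l2.
have SE x : \int[m2]_t ((k1 (x, t) + k2 (x, t)) * g t) = S1 x + S2 x.
  by rewrite -RintegralD//; apply: eq_Rintegral => t _; rewrite mulrDl.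
split.
- move=> x; have := integrableD measurableT (i1 x) (i2 x).
  by congr (_.-integrable _ _); apply/funext => t /=; rewrite -EFinD mulrDl.
- by under eq_fun do rewrite SE; exact: measurable_funD.
have mS12 : measurable_fun setT (fun x => (2 * S1 x ^+ 2)%:E).
  by apply/measurable_EFinP; apply: measurable_funM => //; exact: measurable_funX.
have mS22 : measurable_fun setT (fun x => (2 * S2 x ^+ 2)%:E).
  by apply/measurable_EFinP; apply: measurable_funM => //; exact: measurable_funX.
have fg2 : (\int[m2]_t (g t ^+ 2)%:E)%E \is a fin_num.
  by rewrite ge0_fin_numE// integral_ge0// => t _; rewrite lee_fin sqr_ge0.
apply: (@le_trans _ _ (\int[m1]_x ((2 * S1 x ^+ 2)%:E + (2 * S2 x ^+ 2)%:E))%E).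
  apply: ge0_le_integral => //.
  - by move=> x _; rewrite lee_fin sqr_ge0.
  - apply/measurable_EFinP; apply: measurable_funX.
    by under eq_fun do rewrite SE; exact: measurable_funD.
  - exact: emeasurable_funD.
  - move=> x _; rewrite SE -EFinD lee_fin; have := sqr_ge0 (S1 x - S2 x); lra.
rewrite ge0_integralD//; first last.
- by move=> x _; rewrite lee_fin mulr_ge0 ?sqr_ge0.
- by move=> x _; rewrite lee_fin mulr_ge0 ?sqr_ge0.
under eq_integral do rewrite EFinM.
under [X in (_ + X)%E]eq_integral do rewrite EFinM.
rewrite !ge0_integralZl//; try by move=> x _; rewrite lee_fin sqr_ge0.
- apply: (le_trans (leeD (lee_wpmul2l _ l1) (lee_wpmul2l _ l2))); rewrite ?lee_fin//.
  rewrite -(fineK fg2) -!EFinM -EFinD lee_fin le_eqVlt; apply/orP; left; apply/eqP; ring.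
- by apply/measurable_EFinP; exact: measurable_funX.
- by apply/measurable_EFinP; exact: measurable_funX.
Qed.

(** Schur's test with constant weight, for a symmetric majorant [N] of the T^*T kernel. The integral
    of the squared image becomes the double integral of g(s) g(t) against that kernel. The bound [M]
    on a product of sets of finite measure makes every exchange of integrals absolutely
    convergent. *)
Lemma L2_bounded_TTstar d1 d2 (X : measurableType d1) (Y : measurableType d2)
    (R : realType) (m1 : {sigma_finite_measure set X -> \bar R})
    (m2 : {sigma_finite_measure set Y -> \bar R}) (D : set X) (E : set Y)
    (k : X * Y -> R) (M A : R) (N : Y * Y -> R) :
  measurable D -> (m1 D < +oo)%E -> measurable E -> (m2 E < +oo)%E ->
  measurable_fun setT k -> 0 <= M -> 0 <= A ->
  (forall x y, `|k (x, y)| <= M * (\1_D x * \1_E y)) ->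
  measurable_fun setT N -> (forall s t, 0 <= N (s, t)) ->
  (forall s t, N (s, t) = N (t, s)) ->
  (forall s t, `|\int[m1]_x (k (x, s) * k (x, t))| <= N (s, t)) ->
  (forall s, \int[m2]_t (N (s, t))%:E <= A%:E)%E ->
  L2_bounded m1 m2 k A.
Proof.
move=> mD fD mE fE mk M0 A0 kM mN N0 Nsym KN NA g mg g2.
have i1D : m1.-integrable setT (EFin \o (\1_D : X -> R)).
  apply/integrableP; split; first by apply/measurable_EFinP; exact: measurable_indic.
  under eq_integral do rewrite /= ger0_norm ?indicE//.
  by under eq_integral do rewrite -indicE; rewrite integral_indic// setIT.
have i1E : m2.-integrable setT (EFin \o (\1_E : Y -> R)).
  apply/integrableP; split; first by apply/measurable_EFinP; exact: measurable_indic.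
  under eq_integral do rewrite /= ger0_norm ?indicE//.
  by under eq_integral do rewrite -indicE; rewrite integral_indic// setIT.
have ig2 : m2.-integrable setT (EFin \o (fun t => g t ^+ 2)).
  apply/integrableP; split; first by apply/measurable_EFinP; exact: measurable_funX.
  apply: le_lt_trans g2; apply: ge0_le_integral => //.
  - by apply: measurableT_comp => //; apply/measurable_EFinP; exact: measurable_funX.
  - by apply/measurable_EFinP; exact: measurable_funX.
  - by move=> y _; rewrite /= lee_fin ger0_norm// sqr_ge0.
(* On [E], of finite measure, |g| <= 1 + g^2, so a square-integrable [g] has an integrable
   restriction, as Fubini requires. *)
pose c t : R := \1_E t * `|g t|.
have ic : m2.-integrable setT (EFin \o c).
  apply: (@le_integrable _ _ _ _ _ _ _ (EFin \o (fun t => \1_E t + g t ^+ 2))) => //.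
  - apply/measurable_EFinP; apply: measurable_funM; first exact: measurable_indic.
    exact: measurableT_comp.
  - move=> t _; rewrite /= lee_fin /c.
    have [tE|tE] := boolP (t \in E); rewrite indicE ?tE ?(negbTE tE).
      rewrite mul1r normr_id [leRHS]ger0_norm ?addr_ge0 ?sqr_ge0//.
      rewrite -(real_normK (num_real (g t))) mulr1n.
      by have := sqr_ge0 (`|g t| - 1); have := normr_ge0 (g t); rewrite sqrrB1; lra.
    by rewrite mul0r normr0.
  - exact: (integrableD measurableT i1E ig2).
have mgS : measurable_fun setT (fun z : X * Y => g z.2) by exact: measurableT_comp.
pose S x : R := \int[m2]_t (k (x, t) * g t).
pose u (z : X * Y) : R := k z * g z.2.
have ucx x t : `|u (x, t)| <= (M * \1_D x) * c t.
  rewrite /u normrM /= (le_trans (ler_wpM2r _ (kM _ _)))//.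
  by rewrite /c !mulrA.
have iMD a : m1.-integrable setT (EFin \o (fun x => a * (\1_D x : R))).
  have -> : EFin \o (fun x => a * \1_D x) = (fun x => a%:E * (EFin \o \1_D) x)%E by [].
  exact: integrableZl.
have mu : measurable_fun setT u by exact: measurable_funM.
have [iu1 iu2 iS _ _] := dominated_Fubini (iMD M) ic mu ucx.
pose H : R := \int[m2]_t c t.
have H0 : 0 <= H by apply: Rintegral_ge0 => t _; rewrite /c mulr_ge0// indicE.
have SH x : `|S x| <= M * H.
  apply: (@le_trans _ _ (\int[m2]_t `|u (x, t)|)).
    exact: (le_normr_Rintegral measurableT (iu1 x)).
  rewrite -RintegralZl//; apply: le_Rintegral => //.
  - exact: (integrable_abse (iu1 x)).
  - have -> : EFin \o (fun t => M * c t) = (fun t => M%:E * (EFin \o c) t)%E by [].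
    exact: integrableZl.
  - move=> t _; rewrite (le_trans (ucx _ _))//.
    rewrite ler_wpM2r// ?/c ?mulr_ge0 ?indicE//.
    by rewrite -[leRHS]mulr1 ler_wpM2l//; case: (_ \in _).
have mS : measurable_fun setT S by apply/measurable_EFinP; exact: (measurable_int m1).
split => //.
(* [P] is the adjoint applied to [S]. Writing S^2 as S times the integral that defines S, and
   exchanging, gives the integral of [g t * P t]. *)
pose P t : R := \int[m1]_x (k (x, t) * S x).
have mv : measurable_fun setT (fun z : X * Y => u z * S z.1).
  by apply: measurable_funM => //; exact: measurableT_comp.
have vcx x t : `|u (x, t) * S x| <= (M * (M * H) * \1_D x) * c t.
  rewrite normrM (le_trans (ler_pM _ _ (ucx _ _) (SH _)))//.
  by rewrite le_eqVlt; apply/orP; left; apply/eqP; ring.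
have [iv1 iv2 iv3 iv4 [ev _]] := dominated_Fubini (iMD _) ic mv vcx.
have S2E x : \int[m2]_t (u (x, t) * S x) = S x ^+ 2.
  by rewrite RintegralZr.
have gPE t : \int[m1]_x (u (x, t) * S x) = g t * P t.
  rewrite /P -RintegralZl//; last first.
    apply: (@le_integrable _ _ _ _ _ _ _ (EFin \o (fun x => M * (M * H) * \1_D x))) => //.
    - apply/measurable_EFinP; apply: measurable_funM => //.
      exact: (measurableT_comp mk).
    - move=> x _; rewrite /= lee_fin normrM.
      rewrite (le_trans (ler_pM _ _ (kM _ _) (SH _)))//.
      rewrite (le_trans _ (ler_norm _))//.
      have := ler0n R (x \in D); have := ler0n R (t \in E).
      rewrite !indicE => *; case: (t \in E); case: (x \in D) => //=;
        rewrite ?(mulr0, mulr1, mul0r)//.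
      by rewrite mulr_ge0 // mulr_ge0.
  by apply: eq_Rintegral => x _; rewrite /u/=; ring.
have -> : (\int[m1]_x (S x ^+ 2)%:E = (\int[m2]_t (g t * P t))%:E)%E.
  have <- : \int[m1]_x (S x ^+ 2) = \int[m2]_t (g t * P t).
    under eq_Rintegral do rewrite -S2E; rewrite ev.
    by apply: eq_Rintegral => t _; rewrite gPE.
  rewrite /Rintegral fineK//.
  have := integrable_fin_num measurableT iv3.
  congr (_ \is a fin_num); apply: eq_integral => x _.
  by rewrite /= S2E.
have igP : m2.-integrable setT (EFin \o (fun t => g t * P t)).
  move: iv4; congr (_.-integrable _ _); apply/funext => t /=.
  by rewrite gPE.
have ePE : ((\int[m2]_t (g t * P t))%:E = \int[m2]_t (g t * P t)%:E)%E.
  by rewrite /Rintegral fineK//; exact: (integrable_fin_num measurableT igP).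
rewrite ePE.
(* A second exchange exhibits [P] as the T^*T kernel applied to [g]. *)
have PE t : P t = \int[m2]_s (g s * \int[m1]_x (k (x, s) * k (x, t))) /\
    m2.-integrable setT (EFin \o (fun s => g s * \int[m1]_x (k (x, s) * k (x, t)))).
  have mw : measurable_fun setT (fun z : X * Y => u z * k (z.1, t)).
    apply: measurable_funM => //.
    apply: (measurableT_comp mk); exact: measurable_fun_pair.
  have kMM x s : `|k (x, s)| <= M.
    apply: (le_trans (kM _ _)); rewrite -[leRHS]mulr1 ler_wpM2l//.
  have wcx x s : `|u (x, s) * k (x, t)| <= (M * M * \1_D x) * c s.
    rewrite normrM (le_trans (ler_pM _ _ (ucx _ _) (kMM _ _)))//.
    by rewrite le_eqVlt; apply/orP; left; apply/eqP; ring.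
  have [iw1 iw2 iw3 iw4 [ew _]] := dominated_Fubini (iMD _) ic mw wcx.
  have e1 x : \int[m2]_s (u (x, s) * k (x, t)) = k (x, t) * S x.
    by rewrite RintegralZr// mulrC.
  have e2 s : \int[m1]_x (u (x, s) * k (x, t)) = g s * \int[m1]_x (k (x, s) * k (x, t)).
    rewrite -RintegralZl//; last first.
      apply: (@le_integrable _ _ _ _ _ _ _ (EFin \o (fun x => M * M * \1_D x))) => //.
      - apply/measurable_EFinP; apply: measurable_funM => //;
        exact: (measurableT_comp mk).
      - move=> x _; rewrite /= lee_fin normrM.
        rewrite (le_trans (ler_pM _ _ (kM _ _) (kMM _ _)))//.
        rewrite (le_trans _ (ler_norm _))// !indicE.
        by case: (s \in E); case: (x \in D) => //=; rewrite ?(mulr0, mulr1, mul0r)// mulr_ge0.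
    by apply: eq_Rintegral => x _; rewrite /u/=; ring.
  split.
    rewrite /P; under eq_Rintegral do rewrite -e1; rewrite ew.
    by apply: eq_Rintegral => s _; rewrite e2.
  by move: iw4; congr (_.-integrable _ _); apply/funext => s /=; rewrite e2.
pose G (z : Y * Y) : R := `|g z.1| * (`|g z.2| * N z).
have mG : measurable_fun setT G.
  by apply: measurable_funM; [|apply: measurable_funM => //];
    apply: measurableT_comp => //; exact: measurableT_comp.
have G0 z : 0 <= G z by case: z => s t; rewrite /G !mulr_ge0//.
apply: (@le_trans _ _ (\int[m2]_t \int[m2]_s (G (t, s))%:E)%E).
  apply: (le_trans (lee_abs _)).
  apply: (le_trans (le_abse_integral _ _ _)) => //.
    exact: (measurable_int m2).
  apply: ge0_le_integral => //.
  - by apply: measurableT_comp => //; exact: (measurable_int m2).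
  - apply: (measurable_fun_fubini_tonelli_F (EFin \o G)) => //.
    by apply/measurable_EFinP.
  - move=> t _ /=; have [PtE iPt] := PE t.
    rewrite normrM EFinM /G/=.
    under eq_integral do rewrite EFinM.
    rewrite ge0_integralZl//; last 2 first.
      + apply/measurable_EFinP; apply: measurable_funM; first exact: measurableT_comp.
        exact: (measurableT_comp mN).
      + by move=> s _; rewrite lee_fin mulr_ge0.
    apply: lee_wpmul2l; first by rewrite lee_fin.
    rewrite PtE EFin_normr_Rintegral//.
    apply: (le_trans (le_abse_integral _ _ _)) => //.
      exact: (measurable_int m2).
    apply: ge0_le_integral => //.
    + by apply: measurableT_comp => //; exact: (measurable_int m2).
    + apply/measurable_EFinP; apply: measurable_funM; first exact: measurableT_comp.
      exact: (measurableT_comp mN).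
    + by move=> s _ /=; rewrite lee_fin normrM ler_wpM2l// Nsym KN.
(* [|g s| |g t| <= (g s ^+ 2 + g t ^+ 2) / 2], and [N] is symmetric *)
pose G1 (z : Y * Y) : R := 2^-1 * (g z.1 ^+ 2 * N z).
pose G2 (z : Y * Y) : R := 2^-1 * (g z.2 ^+ 2 * N z).
have mG1 : measurable_fun setT G1.
  by apply: measurable_funM => //; apply: measurable_funM => //;
    apply: measurable_funX; exact: measurableT_comp.
have mG2 : measurable_fun setT G2.
  by apply: measurable_funM => //; apply: measurable_funM => //;
    apply: measurable_funX; exact: measurableT_comp.
have G10 z : 0 <= G1 z by case: z => s t; rewrite /G1; do 2 apply: mulr_ge0 => //; exact: sqr_ge0.
have G20 z : 0 <= G2 z by case: z => s t; rewrite /G2; do 2 apply: mulr_ge0 => //; exact: sqr_ge0.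
have G12 z : G z <= G1 z + G2 z.
  case: z => s t; rewrite /G /G1 /G2 /=.
  rewrite -(real_normK (num_real (g s))) -(real_normK (num_real (g t))).
  rewrite mulrA -mulrDr -mulrDl mulrA ler_wpM2r//.
  have := sqr_ge0 (`|g s| - `|g t|); lra.
have m1' t : measurable_fun setT (fun s => (G1 (t, s))%:E).
  by apply/measurable_EFinP; exact: (measurableT_comp mG1).
have m2' t : measurable_fun setT (fun s => (G2 (t, s))%:E).
  by apply/measurable_EFinP; exact: (measurableT_comp mG2).
have mI1 : measurable_fun setT (fun t => \int[m2]_s (G1 (t, s))%:E)%E.
  apply: (measurable_fun_fubini_tonelli_F (EFin \o G1)); first exact/measurable_EFinP.
  by move=> z; rewrite lee_fin.
have mI2 : measurable_fun setT (fun t => \int[m2]_s (G2 (t, s))%:E)%E.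
  apply: (measurable_fun_fubini_tonelli_F (EFin \o G2)); first exact/measurable_EFinP.
  by move=> z; rewrite lee_fin.
apply: (@le_trans _ _ (\int[m2]_t (\int[m2]_s (G1 (t, s))%:E +
    \int[m2]_s (G2 (t, s))%:E))%E).
  apply: ge0_le_integral => //.
  - by move=> t _; apply: integral_ge0 => s _; rewrite lee_fin.
  - apply: (measurable_fun_fubini_tonelli_F (EFin \o G)); first exact/measurable_EFinP.
    by move=> z; rewrite lee_fin.
  - exact: emeasurable_funD.
  - move=> t _; rewrite -ge0_integralD//; try by move=> s _; rewrite lee_fin.
    apply: ge0_le_integral => //.
    + by move=> s _; rewrite lee_fin.
    + by apply/measurable_EFinP; exact: (measurableT_comp mG).
    + exact: emeasurable_funD.
    + by move=> s _; rewrite -EFinD lee_fin.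
rewrite ge0_integralD//; try by move=> t _; apply: integral_ge0 => s _; rewrite lee_fin.
have -> : (\int[m2]_t \int[m2]_s (G2 (t, s))%:E = \int[m2]_t \int[m2]_s (G1 (t, s))%:E)%E.
  rewrite (fubini_tonelli (EFin \o G2)); first last.
  - by move=> z; rewrite lee_fin.
  - exact/measurable_EFinP.
  by apply: eq_integral => t _; apply: eq_integral => s _; rewrite /G1 /G2 /= Nsym.
have h : (\int[m2]_t \int[m2]_s (G1 (t, s))%:E <= (2^-1 * A)%:E * \int[m2]_t (g t ^+ 2)%:E)%E.
  rewrite -ge0_integralZl//; last 3 first.
  - by apply/measurable_EFinP; exact: measurable_funX.
  - by move=> t _; rewrite lee_fin sqr_ge0.
  - by rewrite lee_fin mulr_ge0.
  apply: ge0_le_integral => //.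
  - by move=> t _; apply: integral_ge0 => s _; rewrite lee_fin.
  - apply/measurable_EFinP/measurable_funM => //; exact: measurable_funX.
  - move=> t _; rewrite /G1/=.
    under eq_integral do rewrite mulrA EFinM.
    rewrite ge0_integralZl//; last 3 first.
    + by apply/measurable_EFinP; exact: (measurableT_comp mN).
    + by move=> s _; rewrite lee_fin.
    + by rewrite lee_fin mulr_ge0// sqr_ge0.
    rewrite -EFinM.
    apply: (@le_trans _ _ ((2^-1 * g t ^+ 2)%:E * A%:E)%E).
      by apply: lee_wpmul2l => //; rewrite lee_fin mulr_ge0// sqr_ge0.
    by rewrite -EFinM lee_fin le_eqVlt; apply/orP; left; apply/eqP; ring.
apply: (le_trans (leeD h h)).
have fg2 : (\int[m2]_t (g t ^+ 2)%:E)%E \is a fin_num.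
  exact: (integrable_fin_num measurableT ig2).
rewrite -(fineK fg2) -!EFinM -EFinD lee_fin.
by rewrite le_eqVlt; apply/orP; left; apply/eqP; field.
Qed.

(** * Sigma-finiteness of a product measure *)

Section ProductSigmaFinite.
Context d1 d2 (X : measurableType d1) (Y : measurableType d2) (R : realType).
Context (m1 : {sigma_finite_measure set X -> \bar R}).
Context (m2 : {sigma_finite_measure set Y -> \bar R}).

(** The exhausting sequences are taken nondecreasing, so the rectangles with equal indices already
    cover the product. *)
Lemma product_measure_sigma_finite : sigma_finite setT (m1 \x m2)%E.
Proof.
have /sigma_finiteP[F [TF ndF Foo]] := sigma_finiteT m1.
have /sigma_finiteP[G [TG ndG Goo]] := sigma_finiteT m2.
exists (fun n => F n `*` G n).
  apply/seteqP; split => // -[x y] _.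
  have [n _ Fx] : (\bigcup_n F n) x by rewrite -TF.
  have [n' _ Gy] : (\bigcup_n G n) y by rewrite -TG.
  exists (maxn n n') => //; split => /=.
    by apply: (subsetPset _ _ (ndF _ _ (leq_maxl n n'))).
  by apply: (subsetPset _ _ (ndG _ _ (leq_maxr n n'))).
move=> n; have [mF Fn] := Foo n; have [mG Gn] := Goo n.
split; first exact: measurableX.
by rewrite product_measure1E// lte_mul_pinfty// ge0_fin_numE.
Qed.

(* The library's instance for a product is shadowed by the one for finite
   measures and is not inferred. *)
Definition sigma_finite_product : {sigma_finite_measure set (X * Y)%type -> \bar R} :=
  HB.pack_for {sigma_finite_measure set (X * Y)%type -> \bar R} (m1 \x m2)%E
    (Measure_isSigmaFinite.Build _ _ _ (m1 \x m2)%E product_measure_sigma_finite).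

End ProductSigmaFinite.

(** * One-dimensional oscillatory integrals *)

(* The function [F] below is nondecreasing because [`|sin| <= 1]. *)
Lemma oscillation_lower (R : realType) n (mu phi r : R) (G : R -> R) :
  mu != 0 ->
  (forall x : R, 0 < x <= r -> is_derive x 1 G (cos (mu * x ^+ n.+1 + phi))) ->
  forall a b : R, 0 < a -> a <= b -> b <= r ->
    - (2 / (`|mu| * a ^+ n)) <= G b - G a.
Proof.
move=> mu0 dG a b a0 ab br.
have [m mE] : exists m : R, m = n.+1%:R by eexists.
have m0 : 0 < m by rewrite mE ltr0n.
have mup : 0 < `|mu| by rewrite normr_gt0.
pose V : R -> R := fun u => ((@id R ^+ n) u)^-1.
pose W : R -> R := fun u => mu * u ^+ n.+1 + phi.
have WE : W = mu \*: (@id R ^+ n.+1) + cst phi by apply/funext => u; rewrite /W fctE /= exprfctE.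
have VE u : V u = u ^- n by rewrite /V exprfctE.
(* The boundary term sin W / (mu m u^n) of an integration by parts has derivative cos W - n sin W /
   (mu m u^(n+1)). Subtracting it from [G] leaves only the second part, with opposite sign, and the
   last term of [F] contributes n / (m |mu| u^(n+1)), which dominates it. *)
pose F : R -> R := G - (mu * m)^-1 \*: ((sin \o W) * V) - (m * `|mu|)^-1 \*: V.
have FE u : F u = G u - (mu * m)^-1 * (sin (W u) * u ^- n) - (m * `|mu|)^-1 * u ^- n.
  by rewrite -VE.
have dF c : a <= c <= b -> is_derive c 1 F
    (n%:R * c ^- n.+1 * ((m * `|mu|)^-1 + (mu * m)^-1 * sin (W c))).
  move=> /andP[ac cb]; have c0 : 0 < c by exact: lt_le_trans ac.
  have cn0 : c != 0 by rewrite gt_eqF.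
  have dV : is_derive c 1 V (- (n%:R * c ^- n.+1)).
    have nz : (@id R ^+ n) c != 0 by rewrite exprfctE expf_neq0.
    have h := is_deriveV nz (is_deriveX n (is_derive_id c 1)).
    apply: (is_derive_eq h); rewrite /= !exprfctE scalerA /GRing.scale /= mulr1.
    case: (n) => [|l /=]; first by rewrite !(mul0r, mulr0) oppr0.
    by rewrite !exprS; field; rewrite cn0 expf_neq0.
  have dW : is_derive c 1 W (mu * m * c ^+ n).
    rewrite WE.
    have h := is_deriveD (is_deriveZ mu (is_deriveX n.+1 (is_derive_id c 1)))
      (is_derive_cst phi c 1).
    apply: (is_derive_eq h).
    by rewrite addr0 /GRing.scale /= mulr1 mE mulrA.
  have dGc : is_derive c 1 G (cos (W c)) by apply: dG; rewrite c0 (le_trans cb).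
  have dS := is_derive1_comp (is_derive_sin (W c)) dW.
  have h := is_deriveB (is_deriveB dGc (is_deriveZ (mu * m)^-1 (is_deriveM dS dV)))
     (is_deriveZ (m * `|mu|)^-1 dV).
  apply: (is_derive_eq h); rewrite /= /GRing.scale /= VE.
  rewrite !exprS; field; rewrite cn0 expf_neq0// mu0 (gt_eqF m0) (gt_eqF mup)//.
have [c cab] : exists2 c, c \in `[a, b] & F b - F a =
  (n%:R * c ^- n.+1 * ((m * `|mu|)^-1 + (mu * m)^-1 * sin (W c))) * (b - a).
  apply: MVT_segment => //.
    move=> x; rewrite in_itv /= => /andP[/ltW ax /ltW xb]; apply: dF; exact/andP.
  apply: derivable_within_continuous => x; rewrite in_itv/= => xab.
  by have [] := dF x xab.
move=> FF.
have : 0 <= F b - F a.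
  have [ac cb] : a <= c /\ c <= b by move: cab; rewrite in_itv /= => /andP.
  have c0 : 0 < c by exact: lt_le_trans ac.
  rewrite FF mulr_ge0 ?subr_ge0//.
  apply: mulr_ge0; first by rewrite mulr_ge0// invr_ge0 exprn_ge0// ltW.
  rewrite -lerBlDl sub0r lerNl -mulNr -invrN; apply: (le_trans (ler_norm _)).
  rewrite normrM normfV normrN normrM (gtr0_norm m0) mulrC [`|mu| * m]mulrC ler_piMl//.
    by rewrite invr_ge0 mulr_ge0// ltW.
  by rewrite ler_norml sin_geN1 sin_le1.
have sinV u : 0 < u -> `|(mu * m)^-1 * (sin (W u) * u ^- n)| <= (m * `|mu|)^-1 * u ^- n.
  move=> u0; rewrite !normrM normfV normrM (gtr0_norm m0) [`|mu| * m]mulrC.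
  rewrite ler_wpM2l//; first by rewrite invr_ge0 mulr_ge0// ltW.
  rewrite normfV [`|u ^+ n|]gtr0_norm ?exprn_gt0// ler_piMl//.
    by rewrite invr_ge0 exprn_ge0// ltW.
  by rewrite ler_norml sin_geN1 sin_le1.
rewrite !FE.
have := sinV a a0; have := sinV b (lt_le_trans a0 ab).
rewrite !ler_norml => /andP[h1 h2] /andP[h3 h4] h5.
(* At [b] the two corrections have nonnegative sum; at [a] each is at most (m |mu| a^n)^-1, which
   produces the 2. *)
have h6 : (m * `|mu|)^-1 * a ^- n <= 1 / (`|mu| * a ^+ n).
  rewrite -invfM div1r lef_pV2 ?posrE ?mulr_gt0 ?exprn_gt0//.
  by rewrite mE -mulrA ler_peMl ?ler1n// mulr_ge0 ?exprn_ge0// ltW.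
lra.
Qed.

(* Below [|mu|^(-1/m)] the bound is trivial, above it oscillation takes over. *)
Lemma oscillation_half_line (R : realType) n (mu phi r : R) (G : R -> R) :
  mu != 0 ->
  (forall x : R, 0 <= x <= r -> is_derive x 1 G (cos (mu * x ^+ n.+1 + phi))) ->
  forall a b : R, 0 <= a -> a <= b -> b <= r ->
    `|G b - G a| <= 3 * `|mu| `^ (- n.+1%:R^-1).
Proof.
move=> mu0 dG a b a0 ab br.
set dl := `|mu| `^ _.
have mup : 0 < `|mu| by rewrite normr_gt0.
have dl0 : 0 < dl by exact: powR_gt0.
(* At [dl] the two estimates balance: below it the length bound gives [dl], above it the oscillation
   bound gives 2 / (|mu| dl^n) = 2 dl. Hence the constant 3. *)
have dlE : `|mu| * dl ^+ n.+1 = 1.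
  rewrite -powR_mulrn ?ltW// -powRrM mulNr mulVf ?pnatr_eq0// powR_inv1 ?ltW//.
  by rewrite divff ?gt_eqF.
have lip x y : 0 <= x -> x <= y -> y <= r -> `|G y - G x| <= y - x.
  move=> x0 xy yr.
  have [c _ ->] : exists2 c, c \in `[x, y] & G y - G x =
      cos (mu * c ^+ n.+1 + phi) * (y - x).
    apply: (@MVT_segment _ _ (fun c => cos (mu * c ^+ n.+1 + phi))) => //.
      move=> z; rewrite in_itv /= => /andP[/ltW xz /ltW zy]; apply: dG.
      by rewrite (le_trans x0 xz) (le_trans zy yr).
    apply: derivable_within_continuous => z; rewrite in_itv/= => /andP[xz zy].
    by have [|//] := dG z; rewrite (le_trans x0 xz) (le_trans zy yr).
  rewrite normrM [`|y - x|]ger0_norm ?subr_ge0// ler_piMl ?subr_ge0//.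
  by rewrite ler_norml cos_geN1 cos_le1.
have dec x y : dl <= x -> x <= y -> y <= r -> `|G y - G x| <= 2 * dl.
  move=> dx xy yr; have x0 : 0 < x by exact: lt_le_trans dx.
  have le2 : 2 / (`|mu| * x ^+ n) <= 2 * dl.
    rewrite ler_pdivrMr ?mulr_gt0 ?exprn_gt0// -mulrA ler_peMr//.
    rewrite mulrCA -dlE ler_wpM2l ?normr_ge0// exprS ler_wpM2l ?(ltW dl0)//.
    by rewrite lerXn2r ?nnegrE ?(ltW x0) ?(ltW dl0).
  have h1 : - (2 / (`|mu| * x ^+ n)) <= G y - G x.
    apply: (@oscillation_lower _ n mu phi r) => // z /andP[z0 zr].
    by apply: dG; rewrite ltW.
  (* The upper bound is the lower bound for [- G], whose derivative is the same cosine with phase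
     shifted by [pi]. *)
  have h2 : - (2 / (`|mu| * x ^+ n)) <= (- G) y - (- G) x.
    apply: (@oscillation_lower _ n mu (phi + pi) r) => // z /andP[z0 zr].
    by rewrite addrA cosDpi; apply: is_deriveN; apply: dG; rewrite ltW.
  rewrite ler_norml; move: h2; rewrite !opprfctE; lra.
have [bd|db] := leP b dl.
  by have := lip a b a0 ab br; lra.
have [da|ad] := leP dl a.
  by have := dec a b da ab br; lra.
have h1 := dec dl b (lexx _) (ltW db) br.
have h2 := lip a dl a0 (ltW ad) (le_trans (ltW db) br).
rewrite -(subrKA (G dl)).
by apply: (le_trans (ler_normD _ _)); lra.
Qed.

(** Split at 0, each half costing 3. The negative half is reflected, which turns [mu] into mu
    (-1)^(n+1) and leaves its absolute value unchanged. *)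
Lemma oscillation_bound (R : realType) n (mu phi r : R) (G : R -> R) :
  mu != 0 ->
  (forall x : R, - r <= x <= r -> is_derive x 1 G (cos (mu * x ^+ n.+1 + phi))) ->
  forall a b : R, - r <= a -> a <= b -> b <= r ->
    `|G b - G a| <= 6 * `|mu| `^ (- n.+1%:R^-1).
Proof.
move=> mu0 dG a b ra ab br.
have pos x y : 0 <= x -> x <= y -> y <= r -> `|G y - G x| <= 3 * `|mu| `^ (- n.+1%:R^-1).
  apply: (@oscillation_half_line _ n mu phi) => // z /andP[z0 zr]; apply: dG.
  by apply/andP; split; lra.
have neg x y : 0 <= x -> x <= y -> y <= r ->
    `|G (- y) - G (- x)| <= 3 * `|mu| `^ (- n.+1%:R^-1).
  have mu1 : mu * (-1) ^+ n.+1 != 0 by rewrite mulf_neq0// expf_neq0// oppr_eq0 oner_neq0.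
  move=> x0 xy yr.
  have := @oscillation_half_line _ n (mu * (-1) ^+ n.+1) phi r (- (G \o -%R)) mu1 _ x y x0 xy yr.
  rewrite normrM normrX normrN1 expr1n mulr1 !opprfctE /= opprK.
  rewrite [in X in _ -> X]distrC [X in `|X| <= _]addrC; apply => z /andP[z0 zr].
  have dGz : is_derive (- z) 1 G (cos (mu * (- z) ^+ n.+1 + phi)).
    by apply: dG; apply/andP; split; lra.
  have h := is_deriveN (is_derive1_comp dGz (is_deriveNid z 1)).
  rewrite (_ : cos _ = - (cos (mu * (- z) ^+ n.+1 + phi) * -1)); first exact: h.
  by rewrite mulrN1 opprK (exprNn z) mulrA.
have dl0 := powR_ge0 `|mu| (- n.+1%:R^-1).
have [a0|/ltW a0] := leP 0 a.
  by have := pos a b a0 ab br; lra.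
have [b0|/ltW b0] := leP b 0.
  have := neg (- b) (- a); rewrite oppr_ge0 lerN2 lerNl !opprK => /(_ b0 ab ra).
  by rewrite distrC; lra.
have h1 := pos 0 b (lexx _) b0 br.
have := neg 0 (- a) (lexx _); rewrite oppr_ge0 lerNl opprK oppr0 => /(_ a0 ra) h2.
rewrite -(subrKA (G 0)).
by apply: (le_trans (ler_normD _ _)); rewrite [`|G 0 - _|]distrC; lra.
Qed.

(** * Integration by parts and primitives on an interval *)

Lemma parts_vanish (R : realType) (r : R) (F f G g : R -> R) :
  0 < r -> continuous f -> continuous g ->
  (forall x, - r <= x <= r -> is_derive x 1 F (f x)) ->
  (forall x, - r <= x <= r -> is_derive x 1 G (g x)) ->
  F (- r) = 0 -> F r = 0 ->
  \int[lebesgue_measure]_(x in `[- r, r]) (F x * g x) =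
  - \int[lebesgue_measure]_(x in `[- r, r]) (f x * G x).
Proof.
move=> r0 cf cg dF dG F1 F2.
have rr : - r < r by lra.
have LR (K k : R -> R) : (forall x, - r <= x <= r -> is_derive x 1 K (k x)) ->
    derivable_oo_LRcontinuous K (- r) r.
  move=> dK.
  have cK x : - r <= x <= r -> {for x, continuous K}.
    move=> xr; apply: differentiable_continuous; apply/derivable1_diffP.
    by have [] := dK x xr.
  split.
  - move=> x; rewrite in_itv/= => /andP[/ltW x1 /ltW x2].
    by have [|//] := dK x; rewrite x1 x2.
  - by apply: cvg_at_right_filter; apply: cK; rewrite lexx ltW.
  - by apply: cvg_at_left_filter; apply: cK; rewrite lexx ltW.
have D1 (K k : R -> R) : (forall x, - r <= x <= r -> is_derive x 1 K (k x)) ->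
    {in `]- r, r[, derive1 K =1 k}.
  move=> dK x; rewrite in_itv/= => /andP[/ltW x1 /ltW x2].
  by rewrite derive1E; have [|_ ->//] := dK x; rewrite x1 x2.
rewrite (@Rintegration_by_parts _ F G f g) ?F1 ?F2 ?mul0r ?subrr ?sub0r//.
- exact: continuous_subspaceT.
- exact: LR.
- exact: D1.
- exact: continuous_subspaceT.
- exact: LR.
- exact: D1.
Qed.

Lemma primitive_exists (R : realType) (r : R) (g : R -> R) :
  continuous g -> exists2 G : R -> R, G (- r) = 0 &
    forall x, - r <= x <= r -> is_derive x 1 G (g x).
Proof.
move=> cg.
(* The base point lies to the left of [- r], so that the derivative at [- r] is two-sided; the
   normalization at [- r] is restored by a constant. *)
pose G x := \int[lebesgue_measure]_(t in `[- r - 1, x]) g t.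
exists (fun x => G x - G (- r)); first by rewrite subrr.
move=> x /andP[rx xr].
have [dG GE] : derivable G x 1 /\ derive1 G x = g x.
  apply: (@continuous_FTC1_closed _ g (- r - 1) x (r + 1)) => //; [lra| |lra|exact: cg].
  apply: continuous_compact_integrable; first exact: segment_compact.
  exact: continuous_subspaceT.
have dGx : is_derive x 1 G (g x) by rewrite -GE derive1E; exact: derivableP.
have h := is_deriveB dGx (is_derive_cst (G (- r)) x 1).
by rewrite subr0 in h.
Qed.

(* [min(1, v^(-e))]; the maximum is taken first since [0 `^ (- e) = 0]. *)
Definition decay {R : realType} (e v : R) : R := Num.max 1 v `^ (- e).

Lemma decay_gt0 (R : realType) (e v : R) : 0 < decay e v.
Proof. by rewrite powR_gt0// lt_max ltr01. Qed.

Lemma decay_le1 (R : realType) (e v : R) : 0 <= e -> decay e v <= 1.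
Proof.
move=> e0.
by rewrite /decay powRN invf_le1 ?powR_gt0 ?lt_max ?ltr01//
  -[leLHS](powRr0 (Num.max 1 v)) ler_powR// le_max lexx.
Qed.

Lemma decay_powR (R : realType) (e v : R) :
  0 <= e -> 0 < v -> decay e v <= v `^ (- e).
Proof.
move=> e0 v0; rewrite /decay !powRN lef_pV2 ?posrE ?powR_gt0 ?lt_max ?ltr01//.
by rewrite ge0_ler_powR// ?nnegrE ?le_max ?ler01 ?(ltW v0) ?lexx ?orbT.
Qed.

Lemma decay_anti (R : realType) (e v w : R) :
  0 <= e -> v <= w -> decay e w <= decay e v.
Proof.
move=> e0 vw.
have mm : Num.max 1 v <= Num.max 1 w by rewrite ge_max !le_max lexx vw orbT.
rewrite /decay !powRN lef_pV2 ?posrE ?powR_gt0 ?lt_max ?ltr01//.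
by rewrite ge0_ler_powR// nnegrE le_max ler01.
Qed.

Lemma continuous_decay (R : realType) (e : R) : continuous (decay e).
Proof.
move=> v; rewrite /decay.
have m0 : 0 < Num.max 1 v by rewrite lt_max ltr01.
have c1 : {for v, continuous (fun v : R => Num.max 1 v)}.
  by apply: (@continuous_max _ _ (cst 1) id); [exact: cvg_cst|exact: cvg_id].
have c2 : {for Num.max 1 v, continuous (@powR R ^~ (- e))}.
  apply: differentiable_continuous; apply/derivable1_diffP.
  by have [] := is_derive1_powR (- e) m0.
exact: (continuous_comp c1 c2).
Qed.

(* The product of cosines is a mean of cosines with frequencies [m1 - m2] and
   [m1 + m2], both at least [| |m1| - |m2| |] in absolute value. *)
Lemma kernel_primitive (R : realType) n (m1 m2 phi r : R) :
  0 <= r -> exists2 G : R -> R,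
  forall x, - r <= x <= r -> is_derive x 1 G
    (cos (m1 * x ^+ n.+1 + phi) * cos (m2 * x ^+ n.+1 + phi)) &
  forall x, - r <= x <= r ->
    `|G x| <= (6 + 2 * r) * decay n.+1%:R^-1 `| `|m1| - `|m2| |.
Proof.
move=> r0.
set e := n.+1%:R^-1; set d : R := `| _ |.
pose p m f (x : R) : R := cos (m * x ^+ n.+1 + f).
have cp m f : continuous (p m f).
  move=> x; have c1 : {for x, continuous (fun x : R => m * x ^+ n.+1 + f)}.
    apply: continuousD; last exact: cvg_cst.
    by apply: continuousM; [exact: cvg_cst|exact: exprn_continuous].
  exact: (continuous_comp c1 (@continuous_cos _ _)).
(* Origin of [6 + 2 * r]: for [d <= 1] the decay is 1 and the length [2 * r] of the interval
   suffices, for [d > 1] the oscillation bound contributes 6. *)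
have bnd m f (G : R -> R) : G (- r) = 0 ->
    (forall x, - r <= x <= r -> is_derive x 1 G (p m f x)) -> d <= `|m| ->
    forall x, - r <= x <= r -> `|G x| <= (6 + 2 * r) * decay e d.
  move=> G0 dG dm x /andP[rx xr].
  have -> : G x = G x - G (- r) by rewrite G0 subr0.
  have D0 : 0 <= (2 * r) * decay e d by rewrite mulr_ge0 ?mulr_ge0 ?(ltW (decay_gt0 _ _)).
  have [d1|d1] := leP d 1.
    have -> : decay e d = 1 by rewrite /decay max_l// powR1.
    have [c _ ->] : exists2 c, c \in `[(- r), x] & G x - G (- r) = p m f c * (x - - r).
      apply: (@MVT_segment _ _ (p m f)) => //.
        move=> z; rewrite in_itv /= => /andP[/ltW z1 /ltW z2]; apply: dG.
        by rewrite z1 (le_trans z2).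
      apply: derivable_within_continuous => z; rewrite in_itv/= => /andP[z1 z2].
      by have [|//] := dG z; rewrite z1 (le_trans z2).
    rewrite normrM [`|x - _|]ger0_norm; last by lra.
    apply: (@le_trans _ _ (x - - r)); last by lra.
    by rewrite ler_piMl; [|lra|rewrite ler_norml cos_geN1 cos_le1].
  have m0 : m != 0 by rewrite -normr_gt0; lra.
  have := @oscillation_bound R n m f r G m0 dG (- r) x (lexx _) rx xr.
  move=> /le_trans; apply.
  suff h : `|m| `^ (- e) <= decay e d by rewrite mulrDl; rewrite -/e; lra.
  have -> : decay e d = d `^ (- e) by rewrite /decay max_r// ltW.
  have d0 : 0 < d by lra.
  rewrite !powRN lef_pV2 ?posrE ?powR_gt0 ?(lt_le_trans d0 dm)//.
  by rewrite ge0_ler_powR// ?nnegrE ?normr_ge0// invr_ge0 ler0n.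
have [G1 G10 dG1] := primitive_exists r (cp (m1 - m2) 0).
have [G2 G20 dG2] := primitive_exists r (cp (m1 + m2) (phi + phi)).
exists (2^-1 \*: (G1 + G2)).
  move=> x xr; have h := is_deriveZ 2^-1 (is_deriveD (dG1 x xr) (dG2 x xr)).
  apply: (is_derive_eq h); rewrite /p /GRing.scale /= addr0.
  set u := m1 * _; set v := m2 * _.
  have -> : (m1 - m2) * x ^+ n.+1 = (u + phi) - (v + phi) by rewrite /u /v; ring.
  have -> : (m1 + m2) * x ^+ n.+1 + (phi + phi) = (u + phi) + (v + phi) by rewrite /u /v; ring.
  by rewrite (cosB (u + phi)) (cosD (u + phi) (v + phi)); field.
move=> x xr; have b1 := bnd _ _ _ G10 dG1 (ler_dist_dist _ _) x xr.
have d2 : d <= `|m1 + m2|.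
  by rewrite /d -[`|m2|]normrN; apply: (le_trans (ler_dist_dist _ _)); rewrite opprK.
have b2 := bnd _ _ _ G20 dG2 d2 x xr.
rewrite /= /GRing.scale/= normrM ger0_norm ?invr_ge0//.
rewrite -ler_pdivlMl ?invr_gt0// invrK fctE; apply: (le_trans (ler_normD _ _)); lra.
Qed.

(** * The kernel of T^*T *)

Lemma Rintegral_indic d (X : measurableType d) (R : realType)
    (mu : {measure set X -> \bar R}) (D : set X) (f : X -> R) :
  \int[mu]_(x in D) f x = \int[mu]_x (\1_D x * f x).
Proof.
rewrite Rintegral_mkcond; apply: eq_Rintegral => x _.
by rewrite patchE indicE; case: (x \in D); rewrite ?mul1r ?mul0r.
Qed.

Lemma le_normr_Rintegral_itv (R : realType) (r K : R) (f : R -> R) :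
  0 <= r -> (lebesgue_measure.-integrable `[- r, r] (EFin \o f)) ->
  (forall x, - r <= x <= r -> `|f x| <= K) ->
  `|\int[lebesgue_measure]_(x in `[- r, r]) f x| <= K * (2 * r).
Proof.
move=> r0 fi fK.
have mI : measurable (`[- r, r] : set (measurableTypeR R)) by exact: measurable_itv.
apply: (le_trans (le_normr_Rintegral mI fi)).
have -> : K * (2 * r) = \int[lebesgue_measure]_(x in `[- r, r]) (K : R).
  rewrite Rintegral_cst//= lebesgue_measure_itv/= lte_fin.
  have [_|?] := ltP (- r) r; first by rewrite -EFinD/=; ring.
  have r00 : r = 0 by lra.
  by rewrite r00 !mulr0.
apply: le_Rintegral => //.
- exact: (integrable_abse fi).
- apply: continuous_compact_integrable; first exact: segment_compact.
  by apply: continuous_subspaceT => x; exact: cvg_cst.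
Qed.

(** Two integrations by parts with an exchange of integrals between them: first in [y], where [b]
    vanishes at the ends, then in [x], where [b_y] does. What remains is the integral of G H bxy
    over a square of area 4 r^2. The bound [M1] provides the majorant for Fubini. *)
Lemma double_parts (R : realType) (r : R) (g h G H : R -> R)
    (b b_y bxy : R -> R -> R) (A B M M1 : R) :
  0 < r -> continuous g -> continuous h ->
  (forall x : R, - r <= x <= r -> is_derive x 1 G (g x)) ->
  (forall y : R, - r <= y <= r -> is_derive y 1 H (h y)) ->
  (forall x, - r <= x <= r -> `|G x| <= A) ->
  (forall y, - r <= y <= r -> `|H y| <= B) ->
  (forall x y : R, is_derive y 1 (b x) (b_y x y)) ->
  (forall x y : R, is_derive x 1 (b_y ^~ y) (bxy x y)) ->
  (forall x, continuous (b_y x)) ->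
  (forall y, continuous (bxy ^~ y)) ->
  (forall x, b x (- r) = 0) -> (forall x, b x r = 0) ->
  (forall y, b_y (- r) y = 0) -> (forall y, b_y r y = 0) ->
  (forall x y, - r <= x <= r -> - r <= y <= r -> `|b_y x y| <= M1) ->
  (forall x y, - r <= x <= r -> - r <= y <= r -> `|bxy x y| <= M) ->
  `|\int[lebesgue_measure]_(x in `[- r, r])
     \int[lebesgue_measure]_(y in `[- r, r]) (g x * h y * b x y)|
   <= 4 * r ^+ 2 * A * B * M.
Proof.
move=> r0 cg ch dG dH GA HB db dby cby cbxy b1 b2 by1 by2 byM bxyM.
have mI : measurable (`[- r, r] : set (measurableTypeR R)) by exact: measurable_itv.
have A0 : 0 <= A by apply: le_trans (GA r _); rewrite ?normr_ge0// lexx andbT; lra.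
have B0 : 0 <= B by apply: le_trans (HB r _); rewrite ?normr_ge0// lexx andbT; lra.
have rr : - r <= 0 <= r by apply/andP; split; lra.
have M10 : 0 <= M1 by apply: le_trans (byM 0 0 rr rr).
have M0 : 0 <= M by apply: le_trans (bxyM 0 0 rr rr).
have ci (f : R -> R) : (forall x, - r <= x <= r -> {for x, continuous f}) ->
    lebesgue_measure.-integrable `[- r, r] (EFin \o f).
  move=> cf; apply: continuous_compact_integrable; first exact: segment_compact.
  by apply: continuous_in_subspaceT => x; rewrite inE/= in_itv/=; exact: cf.
have dc (f : R -> R) (x l : R) : is_derive x 1 f l -> {for x, continuous f}.
  by case=> df _; apply: differentiable_continuous; exact/derivable1_diffP.
have cG x : - r <= x <= r -> {for x, continuous G} by move=> /dG /dc.
have cH x : - r <= x <= r -> {for x, continuous H} by move=> /dH /dc.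
pose c (x : R) : R := \1_(`[- r, r]) x.
have c1 x : - r <= x <= r -> c x = 1.
  by move=> xr; rewrite /c indicE mem_set//= in_itv.
have c0 x : ~ (- r <= x <= r) -> c x = 0.
  by move=> xr; rewrite /c indicE memNset//= in_itv.
(* The integrand left by the first integration by parts, cut off to the square so that Fubini
   applies on the whole plane. *)
pose q (z : R * R) : R := (c z.1 * g z.1) * (c z.2 * H z.2) * b_y z.1 z.2.
have mc : measurable_fun setT c by exact: measurable_indic.
have mcts (f : R -> R) : (forall x, - r <= x <= r -> {for x, continuous f}) ->
    measurable_fun setT (fun x => c x * f x).
  move=> cf; have /integrableP[+ _] := ci f cf.
  move=> /(measurable_restrictT _ mI).
  rewrite restrict_EFin => /measurable_EFinP; congr (measurable_fun _ _).
  apply/funext => x; rewrite patchE /c indicE.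
  by case: (x \in _); rewrite ?mul1r ?mul0r.
(* Continuity in [y] and differentiability in [x], each separately, give joint measurability. *)
have mby : measurable_fun setT (fun z : R * R => b_y z.1 z.2).
  apply: measurable_fun_caratheodory => [y|x] /=; last exact: cby.
  by apply: continuous_measurable_fun => x; apply: dc; exact: dby.
have mq : measurable_fun setT q.
  apply: measurable_funM => //; apply: measurable_funM.
    exact: (measurableT_comp (mcts _ (fun x _ => cg x))).
  exact: (measurableT_comp (mcts _ cH)).
have ic a : lebesgue_measure.-integrable setT (EFin \o (fun x => a * c x)).
  have := integrable_indic_itv (- r) r true false; rewrite /= -/c => icI.
  have -> : EFin \o (fun x => a * c x) = (fun x => a%:E * (EFin \o c) x)%E by [].
  exact: integrableZl.
have [gM gMP] : exists gM : R, forall x, - r <= x <= r -> `|g x| <= gM.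
  have : bounded_set (g @` `[- r, r]).
    apply: compact_bounded; apply: continuous_compact; last exact: segment_compact.
    exact: continuous_subspaceT.
  move=> [K [_ hK]]; exists (K + 1) => x xr.
  by apply: hK; [lra|exists x => //=; rewrite in_itv].
have gM0 : 0 <= gM by apply: le_trans (gMP 0 rr).
have qb x y : `|q (x, y)| <= (gM * c x) * (B * M1 * c y).
  rewrite /q /=.
  have [xr|xr] := boolP (- r <= x <= r); last first.
    by rewrite (c0 x) ?(negbTE xr)// !mul0r normr0 mulr0 mul0r.
  have [yr|yr] := boolP (- r <= y <= r); last first.
    by rewrite (c0 y) ?(negbTE yr)// mul0r mulr0 mul0r normr0 !mulr0.
  rewrite !c1// !mul1r !mulr1 !normrM mulrA ler_pM ?mulr_ge0 ?normr_ge0//; last exact: byM.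
  by rewrite ler_pM ?normr_ge0 ?gMP ?HB.
have [_ _ _ iq2 [swap _]] := dominated_Fubini (ic _) (ic _) mq qb.
have E1 : \int[lebesgue_measure]_(x in `[- r, r])
     \int[lebesgue_measure]_(y in `[- r, r]) (g x * h y * b x y) =
     - \int[lebesgue_measure]_x \int[lebesgue_measure]_y q (x, y).
  rewrite Rintegral_indic -[RHS]mulN1r -RintegralZl//; last first.
    by have [] := dominated_Fubini (ic _) (ic _) mq qb.
  apply: eq_Rintegral => x _; rewrite -/(c x).
  have -> : \int[lebesgue_measure]_(y in `[- r, r]) (g x * h y * b x y) =
      g x * \int[lebesgue_measure]_(y in `[- r, r]) (b x y * h y).
    rewrite -RintegralZl//; first by apply: eq_Rintegral => y _; ring.
    by apply: ci => y yr; apply: continuousM; [apply: dc; exact: db|exact: ch].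
  rewrite (parts_vanish r0 (cby x) ch (fun y _ => db x y) dH (b1 x) (b2 x)).
  have -> : \int[lebesgue_measure]_y q (x, y) =
      c x * g x * \int[lebesgue_measure]_(y in `[- r, r]) (b_y x y * H y).
    rewrite -RintegralZl//; last first.
      by apply: ci => y yr; apply: continuousM; [exact: cby|exact: cH].
    by rewrite [RHS]Rintegral_indic; apply: eq_Rintegral => y _; rewrite /q -/(c y)/=; ring.
  by ring.
have iE y : \int[lebesgue_measure]_x q (x, y) =
    - (c y * (H y * \int[lebesgue_measure]_(x in `[- r, r]) (bxy x y * G x))).
  have -> : \int[lebesgue_measure]_x q (x, y) =
      c y * H y * \int[lebesgue_measure]_(x in `[- r, r]) (b_y x y * g x).
    rewrite -RintegralZl//; last first.
      by apply: ci => x xr; apply: continuousM; [apply: dc; exact: dby|exact: cg].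
    by rewrite [RHS]Rintegral_indic; apply: eq_Rintegral => x _; rewrite /q -/(c x)/=; ring.
  rewrite (parts_vanish r0 (cbxy y) cg (fun x _ => dby x y) dG (by1 y) (by2 y)).
  by ring.
rewrite E1 normrN swap.
have -> : \int[lebesgue_measure]_y \int[lebesgue_measure]_x q (x, y) =
    \int[lebesgue_measure]_(y in `[- r, r]) \int[lebesgue_measure]_x q (x, y).
  rewrite [RHS]Rintegral_indic; apply: eq_Rintegral => y _; rewrite iE -/(c y).
  by rewrite mulrN !mulrA; congr (- (_ * _ * _)); rewrite /c indicE;
    case: (_ \in _); rewrite ?mulr0 ?mulr1.
have -> : 4 * r ^+ 2 * A * B * M = (B * (M * A * (2 * r))) * (2 * r) by ring.
apply: le_normr_Rintegral_itv; first exact: ltW.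
  by apply: (integrableS measurableT) iq2.
move=> y yr; rewrite iE c1// mul1r normrN normrM ler_pM ?normr_ge0//; first exact: HB.
apply: le_normr_Rintegral_itv; first exact: ltW.
  by apply: ci => x xr; apply: continuousM; [exact: cbxy|exact: cG].
by move=> x xr; rewrite normrM ler_pM ?normr_ge0 ?bxyM ?GA.
Qed.

(** Two applications of [measurable_fun_caratheodory], peeling off one coordinate at a time, reach
    the product sigma-algebra. *)
Lemma continuous_measurable3 (R : realType) (f : R * R * R -> R) :
  continuous f -> measurable_fun setT f.
Proof.
move=> cf.
have cid : continuous (fun x : R => x) by move=> x; exact: cvg_id.
have cc (T : topologicalType) (c : T) : continuous (fun _ : R => c).
  by move=> x; exact: cvg_cst.
have cpair (U V : topologicalType) (g : R -> U) (h : R -> V) x :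
    continuous g -> continuous h -> {for x, continuous (fun x => (g x, h x))}.
  by move=> cg ch; exact: (cvg_pair (cg x) (ch x)).
apply: measurable_fun_caratheodory => [t|[x y]]; last first.
  by move=> t; exact: (continuous_comp (cpair _ _ _ _ t (cc (R * R)%type (x, y)) cid) (cf _)).
have cpair2 (y : R) : continuous (fun x : R => (x, y)).
  by move=> x; apply: cpair => //; exact: cc.
apply: measurable_fun_caratheodory => [y|x] /=.
  apply: continuous_measurable_fun => x.
  exact: (continuous_comp (cpair _ _ _ _ x (cpair2 y) (cc R t)) (cf _)).
have cpair3 : continuous (fun y : R => (x, y)).
  by move=> y; apply: cpair => //; exact: cc.
by move=> y; exact: (continuous_comp (cpair _ _ _ _ y cpair3 (cc R t)) (cf _)).
Qed.

(** The directional and the one-variable difference quotients coincide, since the other two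
    coordinates move by [h * 0]. *)
Lemma is_derive_axis_x (R : realType) (f : R * R * R -> R) (x y t : R) :
  derivable f (x, y, t) (1, 0, 0) ->
  is_derive x 1 (fun x => f (x, y, t)) ('D_(1, 0, 0) f (x, y, t)).
Proof.
have E : (fun h : R => h^-1 *: (((fun x => f (x, y, t)) \o shift x) (h *: 1) - f (x, y, t))) =
   (fun h : R => h^-1 *: ((f \o shift (x, y, t)) (h *: (1, 0, 0)) - f (x, y, t))).
  apply/funext => h; congr (_ *: (f _ - _)).
  transitivity (h * 1 + x, h * 0 + y, h * 0 + t); last by [].
  by rewrite !mulr0 !add0r.
by move=> df; split; rewrite /derivable /derive E.
Qed.

Lemma is_derive_axis_y (R : realType) (f : R * R * R -> R) (x y t : R) :
  derivable f (x, y, t) (0, 1, 0) ->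
  is_derive y 1 (fun y => f (x, y, t)) ('D_(0, 1, 0) f (x, y, t)).
Proof.
have E : (fun h : R => h^-1 *: (((fun y => f (x, y, t)) \o shift y) (h *: 1) - f (x, y, t))) =
   (fun h : R => h^-1 *: ((f \o shift (x, y, t)) (h *: (0, 1, 0)) - f (x, y, t))).
  apply/funext => h; congr (_ *: (f _ - _)).
  transitivity (h * 0 + x, h * 1 + y, h * 0 + t); last by [].
  by rewrite !mulr0 !add0r.
by move=> df; split; rewrite /derivable /derive E.
Qed.

Lemma bounded_on_cube (R : realType) (r : R) (f : R * R * R -> R) :
  continuous f -> exists2 M : R, 0 < M & forall x y t,
    - r <= x <= r -> - r <= y <= r -> - r <= t <= r -> `|f (x, y, t)| <= M.
Proof.
move=> cf.
have : bounded_set (f @` ((`[- r, r] `*` `[- r, r]) `*` `[- r, r])).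
  apply: compact_bounded; apply: continuous_compact.
    exact: continuous_subspaceT.
  by apply: compact_setX; [apply: compact_setX|]; exact: segment_compact.
move=> [K [_ hK]]; exists (`|K| + 1); first by rewrite ltr_wpDl.
move=> x y t xr yr tr; apply: hK; last first.
  by exists (x, y, t) => //=; rewrite !in_itv.
by apply: (le_lt_trans (ler_norm K)); rewrite ltrDl.
Qed.

(** Superadditivity of powers for x = (x - y) + y: multiply the induction hypothesis by [x], which
    dominates both summands. *)
Lemma exprB_le (R : realDomainType) (x y : R) n :
  0 <= y -> y <= x -> (x - y) ^+ n.+1 + y ^+ n.+1 <= x ^+ n.+1.
Proof.
move=> y0 yx; have x0 := le_trans y0 yx.
elim: n => [|n IH]; first by rewrite !expr1 subrK.
rewrite exprS (exprS y) (exprS x).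
apply: (le_trans _ (ler_wpM2l x0 IH)); rewrite mulrDr lerD// ler_wpM2r//.
- by rewrite exprn_ge0 ?subr_ge0.
- by rewrite gerBl.
- by rewrite exprn_ge0.
Qed.

Lemma expr_dist_le (R : realDomainType) (x y : R) n :
  0 <= x -> 0 <= y -> `|x - y| ^+ n.+1 <= `|x ^+ n.+1 - y ^+ n.+1|.
Proof.
wlog yx : x y / y <= x => [hw x0 y0|x0 y0].
  by have [yx|/ltW xy] := leP y x; [exact: hw|rewrite distrC [leRHS]distrC; exact: hw].
rewrite !ger0_norm ?subr_ge0//; first by rewrite lerBrDr exprB_le.
by rewrite lerXn2r.
Qed.

Section ScaleKernel.
Context {R : realType}.

Definition decay2 (k p q : nat) (L u : R) : R :=
  decay (k - p)%N%:R^-1 (L * u ^+ p) * decay (k - q)%N%:R^-1 (L * u ^+ q).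

Lemma continuous_decay2 k p q L : continuous (decay2 k p q L).
Proof.
have cd (e : R) n : continuous (fun u : R => decay e (L * u ^+ n)).
  move=> u; have c1 : {for u, continuous (fun u : R => L * u ^+ n)}.
    by apply: continuousM; [exact: cvg_cst|exact: exprn_continuous].
  exact: (continuous_comp c1 (@continuous_decay _ e _)).
by move=> u; exact: (continuousM (cd _ p u) (cd _ q u)).
Qed.

Lemma decay2_ge0 k p q L u : 0 <= decay2 k p q L u.
Proof. by rewrite mulr_ge0// ltW// decay_gt0. Qed.

End ScaleKernel.

Lemma continuous_slice_x (R : realType) (f : R * R * R -> R) (y t : R) :
  continuous f -> continuous (fun x => f (x, y, t)).
Proof.
move=> cf x.
have cx : (fun x : R => x) @ x --> x by exact: cvg_id.
have cc (c : R) : (fun _ : R => c) @ x --> c by exact: cvg_cst.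
have c2 : {for x, continuous (fun x : R => (x, y, t))}.
  exact: (cvg_pair (cvg_pair cx (cc y)) (cc t)).
exact: (continuous_comp c2 (cf _)).
Qed.

Lemma continuous_slice_y (R : realType) (f : R * R * R -> R) (x t : R) :
  continuous f -> continuous (fun y => f (x, y, t)).
Proof.
move=> cf y.
have cy : (fun y : R => y) @ y --> y by exact: cvg_id.
have cc (c : R) : (fun _ : R => c) @ y --> c by exact: cvg_cst.
have c2 : {for y, continuous (fun y : R => (x, y, t))}.
  exact: (cvg_pair (cvg_pair (cc x) cy) (cc t)).
exact: (continuous_comp c2 (cf _)).
Qed.

(** * The amplitude and its real waves *)

Definition outside_cube {R : realType} (w : R * R * R) : Prop :=
  ~ [/\ -1 <= w.1.1 <= 1, -1 <= w.1.2 <= 1 & -1 <= w.2 <= 1].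

(** These are the derivatives met in one integration by parts per variable. The bounds are taken on
    [-2, 2]^3 because the integrations run over [-2, 2], at whose ends an amplitude vanishing off
    [-1, 1]^3 is zero. *)
Lemma amplitude_derivatives (R : realType) (b : R * R * R -> R) :
  classC 2 b ->
  exists bx, exists b_y, exists bxy : R * R * R -> R, exists2 M : R, 0 < M &
  [/\ [/\ continuous b, continuous bx, continuous b_y & continuous bxy],
      forall x y t : R, is_derive x 1 (fun x => b (x, y, t)) (bx (x, y, t)),
      forall x y t : R, is_derive y 1 (fun y => b (x, y, t)) (b_y (x, y, t)),
      forall x y t : R, is_derive x 1 (fun x => b_y (x, y, t)) (bxy (x, y, t)) &
      forall x y t, -2 <= x <= 2 -> -2 <= y <= 2 -> -2 <= t <= 2 ->
       [/\ `|b (x, y, t)| <= M, `|bx (x, y, t)| <= M,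
           `|b_y (x, y, t)| <= M & `|bxy (x, y, t)| <= M]].
Proof.
move=> [cb db].
have x_ax : ((1, 0, 0) : R * R * R) \in axes by rewrite !inE eqxx.
have y_ax : ((0, 1, 0) : R * R * R) \in axes by rewrite !inE eqxx orbT.
have [dbx [cbx _]] := db _ x_ax; have [dby [cby dbyy]] := db _ y_ax.
have [dbxy cbxy] := dbyy _ x_ax; rewrite /= in cbxy; move: cbxy => [cbxy _].
exists (fun w => 'D_(1, 0, 0) b w), (fun w => 'D_(0, 1, 0) b w),
  (fun w => 'D_(1, 0, 0) (fun w => 'D_(0, 1, 0) b w) w).
have [M0 M00 h0] := bounded_on_cube 2 cb.
have [M1 M10 h1] := bounded_on_cube 2 cbx.
have [M2 M20 h2] := bounded_on_cube 2 cby.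
have [M3 M30 h3] := bounded_on_cube 2 cbxy.
exists (M0 + M1 + M2 + M3); first by rewrite !addr_gt0.
split.
- by split; [exact: cb|exact: cbx|exact: cby|exact: cbxy].
- by move=> x y t; apply: is_derive_axis_x; exact: dbx.
- by move=> x y t; apply: is_derive_axis_y; exact: dby.
- by move=> x y t; apply: (@is_derive_axis_x _ (fun w => 'D_(0, 1, 0) b w)); exact: dbxy.
- move=> x y t hx hy ht.
  split.
  + by have := h0 _ _ _ hx hy ht; lra.
  + by have := h1 _ _ _ hx hy ht; lra.
  + by have := h2 _ _ _ hx hy ht; lra.
  + by have := h3 _ _ _ hx hy ht; lra.
Qed.

(** The free phases [f1] and [f2] bring all signed products of sines and cosines into one family, so
    one estimate uniform in them suffices. *)
Definition wave {R : realType} (k p q : nat) (b : R * R * R -> R) (L f1 f2 : R)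
    (w : R * R * R) : R :=
  cos (L * w.2 ^+ p * w.1.1 ^+ (k - p) + f1) *
  cos (L * w.2 ^+ q * w.1.2 ^+ (k - q) + f2) * b w.

Lemma continuous_phase (R : realType) (L f : R) (p n : nat) (u v : R * R * R -> R) :
  continuous u -> continuous v ->
  continuous (fun w => cos (L * u w ^+ p * v w ^+ n + f)).
Proof.
move=> cu cv w.
have cX (h : R * R * R -> R) m : continuous h -> continuous (fun w => h w ^+ m).
  by move=> ch z; exact: (continuous_comp (ch z) (@exprn_continuous _ m (h z))).
have c1 : {for w, continuous (fun w => L * u w ^+ p * v w ^+ n + f)}.
  apply: (@cvgD _ R^o); last exact: cvg_cst.
  by apply: cvgM; [apply: cvgM; [exact: cvg_cst|exact: cX]|exact: cX].
exact: (continuous_comp c1 (@continuous_cos _ _)).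
Qed.

Lemma continuous_wave (R : realType) k p q (b : R * R * R -> R) (L f1 f2 : R) :
  continuous b -> continuous (wave k p q b L f1 f2).
Proof.
move=> cb w.
have c2 : continuous (fun w : R * R * R => w.2) by move=> z; exact: cvg_snd.
have c1 : continuous (fun w : R * R * R => w.1) by move=> z; exact: cvg_fst.
have c11 : continuous (fun w : R * R * R => w.1.1).
  by move=> z; exact: (continuous_comp (c1 z) (@cvg_fst _ _ _ _ _)).
have c12 : continuous (fun w : R * R * R => w.1.2).
  by move=> z; exact: (continuous_comp (c1 z) (@cvg_snd _ _ _ _ _)).
apply: cvgM; last exact: cb.
by apply: cvgM; apply: continuous_phase.
Qed.

Lemma decay_dist (R : realType) (k p : nat) (L s t : R) : (0 < p)%N -> 0 <= L ->
  decay (k - p)%N%:R^-1 `| `|L * s ^+ p| - `|L * t ^+ p| | <=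
  decay (k - p)%N%:R^-1 (L * `| `|s| - `|t| | ^+ p).
Proof.
case: p => // p _ L0; apply: decay_anti; first by rewrite invr_ge0.
rewrite !normrM (ger0_norm L0) -mulrBr normrM (ger0_norm L0) !normrX ler_wpM2l//.
exact: expr_dist_le.
Qed.

Lemma wave_kernel_bound (R : realType) (k p q : nat) (b : R * R * R -> R) :
  (0 < p)%N -> (p < q)%N -> (q < k)%N ->
  classC 2 b -> (forall w, outside_cube w -> b w = 0) ->
  exists2 M : R, 0 < M & forall (L f1 f2 s t : R), 0 <= L ->
    -1 <= s <= 1 -> -1 <= t <= 1 ->
  `|\int[(lebesgue_measure \x lebesgue_measure)%E]_z
     (wave k p q b L f1 f2 (z, s) * wave k p q b L f1 f2 (z, t))| <=
  M * decay2 k p q L `| `|s| - `|t| |.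
Proof.
move=> p0 pq qk Cb b0.
have [bx [b_y [bxy [M M0 [[cb cbx cby cbxy] dbx dby dbxy bM]]]]] := amplitude_derivatives Cb.
(* [4 * 2 ^+ 2] is the area factor of [double_parts] at [r = 2], each [6 + 2 * 2] comes from
   [kernel_primitive], and [4 * M ^+ 2] bounds the mixed derivative of the amplitude product, a sum
   of four products. *)
exists (4 * 2 ^+ 2 * (6 + 2 * 2) * (6 + 2 * 2) * (4 * M ^+ 2)).
  by rewrite !mulr_gt0// ?exprn_gt0//; lra.
move=> L f1 f2 s t L0 s1 t1.
have s2 : -2 <= s <= 2 by move: s1 => /andP[? ?]; apply/andP; split; lra.
have t2 : -2 <= t <= 2 by move: t1 => /andP[? ?]; apply/andP; split; lra.
pose g (x : R) := cos (L * s ^+ p * x ^+ (k - p) + f1) * cos (L * t ^+ p * x ^+ (k - p) + f1).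
pose h (y : R) := cos (L * s ^+ q * y ^+ (k - q) + f2) * cos (L * t ^+ q * y ^+ (k - q) + f2).
have cph (c f : R) n : continuous (fun x : R => cos (c * x ^+ n + f)).
  move=> x; have c1 : {for x, continuous (fun x : R => c * x ^+ n + f)}.
    apply: continuousD; last exact: cvg_cst.
    by apply: continuousM; [exact: cvg_cst|exact: exprn_continuous].
  exact: (continuous_comp c1 (@continuous_cos _ _)).
have cg : continuous g by move=> x; exact: (continuousM (cph _ _ _ x) (cph _ _ _ x)).
have ch : continuous h by move=> x; exact: (continuousM (cph _ _ _ x) (cph _ _ _ x)).
have pk : (p < k)%N := ltn_trans pq qk.
have r20 : 0 <= (2 : R) by [].
have [G dG GA] : exists2 G : R -> R,
    forall x : R, - 2 <= x <= 2 -> is_derive x 1 G (g x) &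
    forall x : R, - 2 <= x <= 2 -> `|G x| <=
      (6 + 2 * 2) * decay (k - p)%N%:R^-1 (L * `| `|s| - `|t| | ^+ p).
  have [G dG GA] := @kernel_primitive R (k - p).-1 (L * s ^+ p) (L * t ^+ p) f1 2 r20.
  rewrite prednK ?subn_gt0// in dG GA; exists G => // x x2.
  by rewrite (le_trans (GA x x2))// ler_wpM2l ?decay_dist//; lra.
have q0 : (0 < q)%N by rewrite (leq_trans _ pq).
have [H dH HB] : exists2 G : R -> R,
    forall x : R, - 2 <= x <= 2 -> is_derive x 1 G (h x) &
    forall x : R, - 2 <= x <= 2 -> `|G x| <=
      (6 + 2 * 2) * decay (k - q)%N%:R^-1 (L * `| `|s| - `|t| | ^+ q).
  have [G' dG' GA'] := @kernel_primitive R (k - q).-1 (L * s ^+ q) (L * t ^+ q) f2 2 r20.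
  rewrite prednK ?subn_gt0// in dG' GA'; exists G' => // x x2.
  by rewrite (le_trans (GA' x x2))// ler_wpM2l ?decay_dist//; lra.
pose c x y : R := b (x, y, s) * b (x, y, t).
pose cy x y : R := b (x, y, s) * b_y (x, y, t) + b (x, y, t) * b_y (x, y, s).
pose cxy x y : R := (b (x, y, s) * bxy (x, y, t) + b_y (x, y, t) * bx (x, y, s)) +
                    (b (x, y, t) * bxy (x, y, s) + b_y (x, y, s) * bx (x, y, t)).
have dc x y : is_derive (y : R) 1 (c x) (cy x y).
  exact: (is_deriveM (dby x y s) (dby x y t)).
have dcy x y : is_derive (x : R) 1 (cy ^~ y) (cxy x y).
  exact: (is_deriveD (is_deriveM (dbx x y s) (dbxy x y t)) (is_deriveM (dbx x y t) (dbxy x y s))).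
have ccy x : continuous (cy x).
  move=> y; have sl f u (cf : continuous f) := @continuous_slice_y R f x u cf y.
  exact: (continuousD (continuousM (sl _ s cb) (sl _ t cby))
    (continuousM (sl _ t cb) (sl _ s cby))).
have ccxy y : continuous (cxy ^~ y).
  move=> x; have sl f u (cf : continuous f) := @continuous_slice_x R f y u cf x.
  exact: (continuousD
    (continuousD (continuousM (sl _ s cb) (sl _ t cbxy)) (continuousM (sl _ t cby) (sl _ s cbx)))
    (continuousD (continuousM (sl _ t cb) (sl _ s cbxy)) (continuousM (sl _ s cby) (sl _ t cbx)))).
(* These make the boundary terms at 2 and -2 vanish. *)
have bx2 (x y u : R) : ~ (-1 <= x <= 1) -> b (x, y, u) = 0 by move=> x1; apply: b0 => -[].
have by2 (x y u : R) : ~ (-1 <= y <= 1) -> b (x, y, u) = 0 by move=> x1; apply: b0 => -[].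
have n2 : ~ (-1 <= (2 : R) <= 1) by move=> /andP[? ?]; lra.
have nN2 : ~ (-1 <= (- 2 : R) <= 1) by move=> /andP[? ?]; lra.
have pr (u v : R) : `|u| <= M -> `|v| <= M -> `|u * v| <= M ^+ 2.
  by move=> uM vM; rewrite normrM expr2 ler_pM.
have cyM x y : -2 <= x <= 2 -> -2 <= y <= 2 -> `|cy x y| <= 2 * M ^+ 2.
  move=> x2 y2; have [h1 _ h2 _] := bM x y s x2 y2 s2; have [h3 _ h4 _] := bM x y t x2 y2 t2.
  by apply: (le_trans (ler_normD _ _)); rewrite mulrDl mul1r lerD ?pr.
have cxyM x y : -2 <= x <= 2 -> -2 <= y <= 2 -> `|cxy x y| <= 4 * M ^+ 2.
  move=> x2 y2; have [h1 h2 h3 h4] := bM x y s x2 y2 s2; have [k1 k2 k3 k4] := bM x y t x2 y2 t2.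
  apply: (le_trans (ler_normD _ _)).
  have -> : 4 * M ^+ 2 = (M ^+ 2 + M ^+ 2) + (M ^+ 2 + M ^+ 2) by ring.
  by apply: lerD; apply: (le_trans (ler_normD _ _)); rewrite lerD ?pr.
have := @double_parts R 2 g h G H c cy cxy _ _ _ _ _ cg ch dG dH GA HB dc dcy ccy ccxy
  _ _ _ _ cyM cxyM.
have -> : \int[(lebesgue_measure \x lebesgue_measure)%E]_z
     (wave k p q b L f1 f2 (z, s) * wave k p q b L f1 f2 (z, t)) =
   \int[lebesgue_measure]_(x in `[-2, 2])
     \int[lebesgue_measure]_(y in `[-2, 2]) (g x * h y * c x y).
  (* The product of waves vanishes when [x] or [y] leaves [-1, 1], so inserting the indicator of
     [-2, 2] in each variable changes nothing. *)
  pose I (x : R) : R := \1_(`[-2, 2]) x.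
  pose qq (z : R * R) := wave k p q b L f1 f2 (z, s) * wave k p q b L f1 f2 (z, t).
  have I01 x : I x = 1 \/ I x = 0 /\ ~ (-1 <= x <= 1).
    rewrite /I indicE; case: (boolP (x \in _)) => [_|xI]; [by left|right; split => //].
    move=> /andP[x1 x2]; move/negP: xI; apply; rewrite inE /= in_itv/=.
    by apply/andP; split; lra.
  have qE x y : qq (x, y) = I x * (I y * (g x * h y * c x y)).
    rewrite /qq /wave /g /h /c /=.
    have [->|[-> x1]] := I01 x; last by rewrite (bx2 x y s x1) !(mulr0, mul0r).
    have [->|[-> y1]] := I01 y; last by rewrite (by2 x y s y1) !(mulr0, mul0r).
    ring.
  have cos1 (u : R) : `|cos u| <= 1 by rewrite ler_norml cos_geN1 cos_le1.
  have wM z u : `|wave k p q b L f1 f2 (z, u)| <= `|b (z, u)|.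
    by rewrite /wave !normrM ler_piMl// mulr_ile1.
  have qb x y : `|qq (x, y)| <= (M ^+ 2 * I x) * (1 * I y).
    have [Ix|[Ix x1]] := I01 x; last by rewrite qE Ix !(mulr0, mul0r) normr0.
    have [Iy|[Iy y1]] := I01 y; last by rewrite qE Iy !(mulr0, mul0r) normr0.
    rewrite Ix Iy !mulr1 /qq normrM expr2.
    have xy2 (u : R) : I u = 1 -> -2 <= u <= 2.
      rewrite /I indicE; case: (boolP (u \in _)) => [+ _|_ /eqP]; first by rewrite inE /= in_itv.
      by rewrite eq_sym oner_eq0.
    have [h1 _ _ _] := bM x y s (xy2 _ Ix) (xy2 _ Iy) s2.
    have [h2 _ _ _] := bM x y t (xy2 _ Ix) (xy2 _ Iy) t2.
    by rewrite ler_pM// (le_trans (wM _ _)).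
  have mw := continuous_measurable3 (@continuous_wave R k p q b L f1 f2 cb).
  have mq : measurable_fun setT qq.
    by apply: measurable_funM; exact: measurable_fun_pair1.
  have ic (a : R) : lebesgue_measure.-integrable setT (EFin \o (fun x : R => a * I x)).
    have := integrable_indic_itv (-2 : R) 2 true false; rewrite /= -/I => icI.
    have -> : EFin \o (fun x : R => a * I x) = (fun x => a%:E * (EFin \o I) x)%E by [].
    exact: integrableZl.
  have [iq _ _ _ [_ ->]] := dominated_Fubini (ic _) (ic _) mq qb.
  rewrite [RHS]Rintegral_indic; apply: eq_Rintegral => x _; rewrite -/(I x).
  under eq_Rintegral do rewrite qE.
  have [Ix|[Ix _]] := I01 x; rewrite Ix.
    by rewrite mul1r [RHS]Rintegral_indic; apply: eq_Rintegral => y _; rewrite mul1r.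
  rewrite mul0r; under eq_Rintegral do rewrite mul0r.
  by rewrite /Rintegral integral0.
move=> dp.
rewrite (_ : _ * decay2 _ _ _ _ _ = 4 * 2 ^+ 2 *
   ((6 + 2 * 2) * decay (k - p)%N%:R^-1 (L * `| `|s| - `|t| | ^+ p)) *
   ((6 + 2 * 2) * decay (k - q)%N%:R^-1 (L * `| `|s| - `|t| | ^+ q)) * (4 * M ^+ 2)); last first.
  by rewrite /decay2; ring.
apply: dp => //.
- by move=> x; rewrite /c by2// mul0r.
- by move=> x; rewrite /c by2// mul0r.
- by move=> y; rewrite /cy !bx2// !mul0r addr0.
- by move=> y; rewrite /cy !bx2// !mul0r addr0.
Qed.

(** * The exponents *)

(** Mean value theorem for [G - F]: increments of primitives are compared without any integral. *)
Lemma le_primitive (R : realType) (F f G g : R -> R) (a b : R) :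
  a <= b ->
  (forall x : R, a <= x <= b -> is_derive x 1 F (f x)) ->
  (forall x : R, a <= x <= b -> is_derive x 1 G (g x)) ->
  (forall x : R, a <= x <= b -> f x <= g x) ->
  F b - F a <= G b - G a.
Proof.
move=> ab dF dG fg.
have dH (x : R) : a <= x <= b -> is_derive x 1 (G - F) (g x - f x).
  by move=> xab; exact: is_deriveB (dG x xab) (dF x xab).
have [c cab] : exists2 c, c \in `[a, b] & (G - F) b - (G - F) a = (g c - f c) * (b - a).
  apply: (@MVT_segment _ _ (fun x => g x - f x)) => //.
    by move=> x; rewrite in_itv /= => /andP[/ltW ax /ltW xb]; apply: dH; rewrite ax xb.
  by apply: derivable_within_continuous => x; rewrite in_itv/= => /dH[].
move: cab; rewrite in_itv/= => /fg fgc /[!fctE] e.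
have : 0 <= (g c - f c) * (b - a) by rewrite mulr_ge0 ?subr_ge0.
rewrite -e; lra.
Qed.

Lemma power_primitive (R : realType) (F f : R -> R) (al c a b : R) :
  0 < a -> a <= b -> 0 <= c ->
  (forall x : R, a <= x <= b -> is_derive x 1 F (f x)) ->
  (forall x : R, a <= x <= b -> f x <= c * x `^ (- al)) ->
  [/\ al < 1 -> F b - F a <= c * b `^ (1 - al) * `|1 - al|^-1,
      al = 1 -> F b - F a <= c * (ln b - ln a) &
      1 < al -> F b - F a <= c * a `^ (1 - al) * `|1 - al|^-1].
Proof.
move=> a0 ab c0 dF fc.
have pos x : a <= x <= b -> 0 < x by move=> /andP[ax _]; exact: lt_le_trans ax.
have gen : al != 1 -> F b - F a <= c * (1 - al)^-1 * (b `^ (1 - al) - a `^ (1 - al)).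
  move=> al1; have al1' : 1 - al != 0 by rewrite subr_eq0 eq_sym.
  have := @le_primitive R F f ((c * (1 - al)^-1) \*: (@powR R ^~ (1 - al)))
    (fun x => c * x `^ (- al)) a b ab dF _ fc.
  rewrite mulrBr; apply => x xab.
  have h := is_deriveZ (c * (1 - al)^-1) (is_derive1_powR (1 - al) (pos x xab)).
  apply: (is_derive_eq h); rewrite /GRing.scale/=.
  have -> : 1 - al - 1 = - al by ring.
  by field.
have pa := powR_ge0 a (1 - al); have pb := powR_ge0 b (1 - al).
split => al1.
- have i0 : 0 <= (1 - al)^-1 by rewrite invr_ge0 subr_ge0 ltW.
  have := gen (negbT (lt_eqF al1)); rewrite gtr0_norm ?subr_gt0//.
  have := mulr_ge0 (mulr_ge0 c0 i0) pa; lra.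
- have := @le_primitive R F f (c \*: (@ln R)) (fun x => c * x `^ (- al)) a b ab dF _ fc.
  rewrite mulrBr; apply => x xab.
  have h := is_deriveZ c (is_derive1_ln (pos x xab)).
  by apply: (is_derive_eq h); rewrite al1 powR_inv1// ltW// pos.
- have i0 : 0 <= - (1 - al)^-1 by rewrite oppr_ge0 invr_le0 subr_le0 ltW.
  have := gen (negbT (gt_eqF al1)); rewrite ltr0_norm ?subr_lt0// invrN.
  have := mulr_ge0 (mulr_ge0 c0 i0) pb; lra.
Qed.

(** Between the breakpoints [d1] and [d2] only the first decay is used, giving the power u^(-al);
    above [d2] both are, giving u^(-be). Off the critical exponents each piece is governed by one of
    its ends, and the contributions of [d1], [d2] and 2 have sizes L^(-2 rho3), L^(-2 rho2) and
    L^(-2 rho1). Whichever ends win, [rho_star] covers them. An arbitrary primitive is allowed so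
    that both half-lines can be treated later. *)
Lemma decay_primitive_bound (R : realType) (k p q : nat) :
  (0 < p)%N -> (p < q)%N -> (q < k)%N ->
  exists2 C : R, 0 < C & forall L : R, expR 1 <= L -> forall F : R -> R,
    (forall u : R, 0 <= u <= 2 -> is_derive u 1 F
      (decay (k - p)%N%:R^-1 (L * u ^+ p) * decay (k - q)%N%:R^-1 (L * u ^+ q))) ->
    F 2 - F 0 <= C * (L `^ (- rho_star R k p q)) ^+ 2 * ln L ^+ log_power R k p q.
Proof.
move=> p0 pq qk.
have aux (x y : R) : 0 <= x -> 0 <= y -> x <= 2 * x + 2 * y by lra.
have [P PE] : exists P : R, P = p%:R by eexists.
have [Q QE] : exists Q : R, Q = q%:R by eexists.
have [P' P'E] : exists P' : R, P' = (k - p)%N%:R by eexists.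
have [Q' Q'E] : exists Q' : R, Q' = (k - q)%N%:R by eexists.
have pk : (p < k)%N := ltn_trans pq qk.
have Pp : 0 < P by rewrite PE ltr0n.
have Qp : 0 < Q by rewrite QE ltr0n (leq_trans _ pq).
have P'p : 0 < P' by rewrite P'E ltr0n subn_gt0.
have Q'p : 0 < Q' by rewrite Q'E ltr0n subn_gt0.
have PQ : P < Q by rewrite PE QE ltr_nat.
have kP : k%:R - P = P' by rewrite P'E natrB ?PE// ltnW.
have kQ : k%:R - Q = Q' by rewrite Q'E natrB ?QE// ltnW.
set rs := rho_star R k p q; set ga := log_power R k p q.
have R1 : rho1 R k p q = 2^-1 * (1 / P' + 1 / Q').
  by rewrite /rho1 -PE -QE kP kQ; field; rewrite !gt_eqF.
have R2 : rho2 R k p q = 2^-1 * (1 / P' + (1 - P / P') / Q).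
  by rewrite /rho2 -PE -QE kP; field; rewrite !gt_eqF.
have R3 : rho3 R p = 2^-1 * (1 / P) by rewrite /rho3 -PE; field; rewrite !gt_eqF.
have r1 : rs <= 2^-1 * (1 / P' + 1 / Q') by rewrite -R1 /rs /rho_star ge_min lexx.
have r2 : rs <= 2^-1 * (1 / P' + (1 - P / P') / Q).
  by rewrite -R2 /rs /rho_star !ge_min lexx orbT.
have r3 : rs <= 2^-1 * (1 / P) by rewrite -R3 /rs /rho_star !ge_min lexx !orbT.
(* Critical exponents: [al = 1] means k = 2p, and [be = 1] is the other logarithmic condition. *)
pose al : R := P / P'. pose be : R := P / P' + Q / Q'.
have ga_al : al = 1 -> ga = 1%N.
  move=> al1; have PP' : P = P' by rewrite -[LHS](divfK (lt0r_neq0 P'p)) -/al al1 mul1r.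
  rewrite /ga /log_power; case: eqP => // /eqP k2; exfalso; move/eqP: k2; apply.
  by apply/eqP; rewrite -(eqr_nat R) natrM -PE -(subrK P k%:R) kP -PP'; apply/eqP; ring.
(* When [be = 1], rho2 equals rho1 and rho1 <= rho3, so the requirement [rho_star = rho1] in
   [log_power] holds automatically. *)
have ga_be : be = 1 -> ga = 1%N.
  move=> be1; rewrite /ga /log_power; case: ifP => // _.
  rewrite -PE -QE kP kQ -/be be1 eqxx andbT ifT//; apply/eqP.
  rewrite /rho_star min_l// le_min R1 R2 R3; apply/andP; split.
    have -> : 1 - P / P' = Q / Q' by rewrite -be1 /be; ring.
    by rewrite mulrAC divff ?gt_eqF.
  rewrite ler_wpM2l ?invr_ge0// ler_pdivlMr//.
  have -> : (1 / P' + 1 / Q') * P = be - (Q - P) / Q' by rewrite /be; field; rewrite !gt_eqF.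
  by rewrite be1 gerBl divr_ge0 ?subr_ge0// ltW.
(* One summand per interval. At a critical exponent the inverse is 0 by convention, and [+ 1] or
   [+ 2] pays for the logarithm. The 2s come from 2^(1 - be) <= 2 and ln 2 + (ln L) / q <= 2 ln
   L. *)
exists (1 + (`|1 - al|^-1 + 1) + (2 * `|1 - be|^-1 + 2)).
  have ia : 0 <= `|1 - al|^-1 by rewrite invr_ge0.
  have ib : 0 <= `|1 - be|^-1 by rewrite invr_ge0.
  by lra.
move=> L Le F dF.
have L1 : 1 <= L by apply: le_trans Le; rewrite -[leLHS]expR0 ler_expR.
have Lp : 0 < L by lra.
have lnL : 1 <= ln L by rewrite -[leLHS](expRK 1) ler_ln// posrE ?expR_gt0.
set T := (L `^ (- rs)) ^+ 2 * ln L ^+ ga.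
have LT e : 2^-1 * e >= rs -> L `^ (- e) <= (L `^ (- rs)) ^+ 2.
  move=> ers; rewrite expr2 -powRD; last by rewrite (gt_eqF Lp) implybT.
  by rewrite ler_powR//; lra.
have LTln e : 2^-1 * e >= rs -> ga = 1%N -> L `^ (- e) * ln L <= T.
  by move=> ers g1; rewrite /T g1 expr1 ler_wpM2r ?LT//; lra.
(* Since [ln L >= 1], the factor [ln L ^+ ga] may be inserted even where no logarithm arises. *)
have {}LT e : 2^-1 * e >= rs -> L `^ (- e) <= T.
  move=> ers; apply: (le_trans (LT e ers)).
  by rewrite ler_peMr ?exprn_ge0 ?powR_ge0// exprn_ege1.
pose J u : R := decay (k - p)%N%:R^-1 (L * u ^+ p) * decay (k - q)%N%:R^-1 (L * u ^+ q).
set d1 := L `^ (- (1 / P)); set d2 := L `^ (- (1 / Q)).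
have d10 : 0 < d1 by exact: powR_gt0.
have d20 : 0 < d2 by exact: powR_gt0.
have d12 : d1 <= d2.
  by rewrite ler_powR// lerN2 !div1r lef_pV2 ?posrE// ltW.
have d21 : d2 <= 1.
  by rewrite -[leRHS](powRr0 L) ler_powR// oppr_le0 divr_ge0// ltW.
have iP' : 0 <= (k - p)%N%:R^-1 :> R by rewrite invr_ge0.
have iQ' : 0 <= (k - q)%N%:R^-1 :> R by rewrite invr_ge0.
have T0 : 0 <= T by apply: le_trans (LT _ r3); exact: powR_ge0.
have D1 : F d1 - F 0 <= T.
  apply: (le_trans _ (LT _ r3)).
  have := @le_primitive R F _ id (cst 1) 0 d1 (ltW d10) _ _ _.
  rewrite subr0; apply.
  - by move=> x /andP[x0 x1]; apply: dF;
      rewrite x0 (le_trans x1 (le_trans d12 (le_trans d21 _)))// ler1n.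
  - by move=> x _; rewrite mulr_ile1 ?decay_le1 ?(ltW (decay_gt0 _ _)).
have powE (n : nat) (N W u : R) : N = n%:R -> 0 < u ->
    (L * u ^+ n) `^ (- W^-1) = L `^ (- (1 / W)) * u `^ (- (N / W)).
  move=> NE u0; rewrite powRM ?exprn_ge0 ?(ltW Lp) ?(ltW u0)//.
  rewrite -powR_mulrn ?(ltW u0)// -powRrM -NE div1r mulrN.
  by [].
have mulE (e e' : R) : L `^ (- e) * L `^ (- e') = L `^ (- (e + e')).
  by rewrite -powRD ?(gt_eqF Lp) ?implybT//; congr powR; ring.
have dE (e e' : R) : (L `^ (- (1 / e))) `^ e' = L `^ (- (e' / e)).
  by rewrite -powRrM; congr powR; ring.
have D2 : F d2 - F d1 <= (`|1 - al|^-1 + 1) * T.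
  have dFc (x : R) : d1 <= x <= d2 -> is_derive x 1 F (J x).
    by move=> /andP[x1 x2]; apply: dF;
      rewrite (le_trans (ltW d10) x1) (le_trans x2 (le_trans d21 _))// ler1n.
  have fc (x : R) : d1 <= x <= d2 -> J x <= L `^ (- (1 / P')) * x `^ (- al).
    move=> /andP[x1 x2]; have x0 : 0 < x by exact: lt_le_trans x1.
    apply: (@le_trans _ _ (decay (k - p)%N%:R^-1 (L * x ^+ p))).
      by rewrite ler_piMr ?decay_le1 ?(ltW (decay_gt0 _ _)).
    rewrite /al -(powE p P P' x PE x0) P'E decay_powR// mulr_gt0// exprn_gt0//.
  have [h1 h2 h3] := power_primitive d10 d12 (powR_ge0 L _) dFc fc.
  have K0 : 0 <= `|1 - al|^-1 by rewrite invr_ge0.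
  have KT := mulr_ge0 K0 T0.
  have [al1|al1|al1] := ltgtP al 1.
  - apply: (le_trans (h1 al1)); rewrite dE mulE.
    apply: (@le_trans _ _ (`|1 - al|^-1 * T)); last by rewrite mulrDl mul1r lerDl.
    by rewrite mulrC ler_wpM2l// LT// r2.
  - apply: (le_trans (h3 al1)); rewrite dE mulE.
    apply: (@le_trans _ _ (`|1 - al|^-1 * T)); last by rewrite mulrDl mul1r lerDl.
    rewrite mulrC ler_wpM2l// LT//.
    rewrite (_ : _ + _ = 1 / P)//; rewrite /al; field; by rewrite !gt_eqF.
  - apply: (le_trans (h2 al1)); rewrite !ln_powR -mulrBl.
    have PP' : P = P' by rewrite -[LHS](divfK (lt0r_neq0 P'p)) -/al al1 mul1r.
    have := LTln _ r3 (ga_al al1); rewrite -PP' => lt.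
    apply: (@le_trans _ _ T); last by rewrite mulrDl mul1r lerDr.
    apply: le_trans lt; rewrite ler_wpM2l ?powR_ge0//.
    rewrite ler_piMl ?(le_trans ler01)//.
    have i1 : 1 / P <= 1 by rewrite ler_pdivrMr// mul1r PE ler1n.
    have i2 : 0 <= 1 / Q by rewrite divr_ge0// ltW.
    by rewrite opprK addrC (le_trans _ i1)// gerBl.
have D3 : F 2 - F d2 <= (2 * `|1 - be|^-1 + 2) * T.
  have d22 : d2 <= 2 by rewrite (le_trans d21)// ler1n.
  have dFc (x : R) : d2 <= x <= 2 -> is_derive x 1 F (J x).
    by move=> /andP[x1 x2]; apply: dF; rewrite (le_trans (ltW d20) x1).
  have fc (x : R) : d2 <= x <= 2 -> J x <= L `^ (- (1 / P' + 1 / Q')) * x `^ (- be).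
    move=> /andP[x1 x2]; have x0 : 0 < x by exact: lt_le_trans x1.
    have -> : L `^ (- (1 / P' + 1 / Q')) * x `^ (- be) =
        (L `^ (- (1 / P')) * x `^ (- (P / P'))) * (L `^ (- (1 / Q')) * x `^ (- (Q / Q'))).
      rewrite -mulE /be opprD powRD ?(gt_eqF x0) ?implybT//; ring.
    rewrite -(powE p P P' x PE x0) -(powE q Q Q' x QE x0) P'E Q'E.
    by rewrite ler_pM ?(ltW (decay_gt0 _ _)) ?decay_powR ?mulr_gt0 ?exprn_gt0.
  have [h1 h2 h3] := power_primitive d20 d22 (powR_ge0 L _) dFc fc.
  have K0 : 0 <= `|1 - be|^-1 by rewrite invr_ge0.
  have KT := mulr_ge0 K0 T0.
  rewrite mulrDl -mulrA.
  have [be1|be1|be1] := ltgtP be 1.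
  - apply: (le_trans (h1 be1)).
    apply: (@le_trans _ _ (2 * (`|1 - be|^-1 * T))); last by rewrite lerDl mulr_ge0.
    rewrite [leRHS]mulrCA [leLHS]mulrC ler_wpM2l// [leLHS]mulrC.
    rewrite ler_pM ?powR_ge0 ?LT//.
    rewrite -[leRHS]powRr1// ler_powR ?ler1n// gerBl.
    by rewrite /be addr_ge0// divr_ge0// ltW.
  - apply: (le_trans (h3 be1)); rewrite dE mulE.
    apply: (@le_trans _ _ (`|1 - be|^-1 * T)); last exact: aux.
    rewrite mulrC ler_wpM2l// LT//.
    rewrite (_ : _ + _ / Q = 1 / P' + (1 - P / P') / Q)//; rewrite /be; field; by rewrite !gt_eqF.
  - apply: (le_trans (h2 be1)); rewrite ln_powR.
    apply: (@le_trans _ _ (2 * T)); last by rewrite lerDr mulr_ge0.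
    apply: (@le_trans _ _ (2 * (L `^ (- (1 / P' + 1 / Q')) * ln L))); last first.
      by rewrite ler_wpM2l// LTln// ga_be.
    rewrite mulrCA ler_wpM2l ?powR_ge0//.
    have l2 : ln 2 <= ln L.
      rewrite ler_ln ?posrE//; apply: le_trans Le.
      by have := expR_ge1Dx (1 : R); rewrite -[2]/(1 + 1).
    have i1 : 1 / Q <= 1 by rewrite ler_pdivrMr// mul1r QE ler1n (leq_trans _ pq).
    have : 1 / Q * ln L <= ln L by rewrite ler_piMl// (le_trans ler01).
    lra.
have -> : F 2 - F 0 = (F d1 - F 0) + (F d2 - F d1) + (F 2 - F d2) by ring.
by rewrite -mulrA -/T (mulrDl _ _ T) (mulrDl 1) mul1r !lerD.
Qed.

(** The 4 counts two translates of the even function u -> decay2 |u|, by [s] and by [- s], each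
    covering two half-lines. *)
Lemma decay2_integral (R : realType) (k p q : nat) :
  (0 < p)%N -> (p < q)%N -> (q < k)%N ->
  exists2 C : R, 0 < C & forall L : R, expR 1 <= L -> forall s : R, -1 <= s <= 1 ->
    (\int[lebesgue_measure]_t
        ((\1_(`[-1, 1]) t : R) * decay2 k p q L `| `|s| - `|t| |)%:E <=
     (C * (L `^ (- rho_star R k p q)) ^+ 2 * ln L ^+ log_power R k p q)%:E)%E.
Proof.
move=> p0 pq qk; have [C C0 hC] := @decay_primitive_bound R k p q p0 pq qk.
exists (4 * C); first by rewrite mulr_gt0.
move=> L Le s s1.
pose g (u : R) := decay2 k p q L `|u|.
have cg : continuous g.
  move=> u; exact: (continuous_comp (@norm_continuous _ _ u) (@continuous_decay2 _ k p q L _)).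
have g0 u : 0 <= g u by exact: decay2_ge0.
have [G _ dG] := primitive_exists 2 cg.
have dcst (x : R) : is_derive x 1 (cst 0 : R -> R) 0 by exact: is_derive_cst.
have incr (a b : R) : - 2 <= a -> a <= b -> b <= 2 -> G a <= G b.
  move=> a2 ab b2; rewrite -subr_ge0.
  have := @le_primitive R (cst 0) (cst 0) G g a b ab (fun x _ => dcst x) _ (fun x _ => g0 x).
  rewrite subrr; apply => x /andP[ax xb]; apply: dG.
  by rewrite (le_trans a2 ax) (le_trans xb b2).
have {}hC := hC L Le; set B := C * _ * _ in hC.
have GB1 : G 2 - G 0 <= B.
  apply: hC => u /andP[u0 u2].
  have := dG u; rewrite /g ger0_norm//; apply; rewrite u2 andbT; lra.
have GB2 : G 0 - G (- 2) <= B.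
  (* By evenness the reflected primitive u -> - G (-u) has the same derivative on [0, 2]. *)
  have := hC (- (G \o -%R)); rewrite !opprfctE /= oppr0 opprK [- _ + _]addrC.
  apply => u /andP[u0 u2].
  have := dG (- u); rewrite /g normrN ger0_norm// => dGu.
  have dGu' : is_derive (- u) 1 G (decay2 k p q L u) by apply: dGu; apply/andP; split; lra.
  have h := is_deriveN (is_derive1_comp dGu' (is_deriveNid u 1)).
  by rewrite mulrN1 opprK in h.
have mI : measurable (`[-1, 1] : set (measurableTypeR R)) by exact: measurable_itv.
(* The translate of [-1, 1] by [c] stays in [-2, 2], over which the nondecreasing [G] gains at most
   [B + B]. *)
have shift (c : R) : -1 <= c <= 1 ->
    (\int[lebesgue_measure]_(t in `[(-1)%R, 1%R]) (g (t + c)%R)%:E <= (B + B)%:E)%E.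
  move=> /andP[c1 c2].
  have ccg : continuous (fun t : R => g (t + c)).
    move=> t; have c1' : {for t, continuous (fun u : R => u + c)}.
      by apply: continuousD; [exact: cvg_id|exact: cvg_cst].
    exact: (continuous_comp c1' (cg _)).
  have dGc (t : R) : -1 <= t <= 1 -> is_derive t 1 (fun t => G (t + c)) (g (t + c)).
    move=> /andP[t1 t2].
    have dc : is_derive t 1 (id + cst c) (1 : R).
      by have h := is_deriveD (is_derive_id t 1) (is_derive_cst c t 1); rewrite addr0 in h.
    have dGt : is_derive (t + c) 1 G (g (t + c)) by apply: dG; apply/andP; split; lra.
    by have h := @is_derive1_comp _ G (id + cst c) t _ _ dGt dc; rewrite mulr1 in h.
  have dc (t : R) : -1 <= t <= 1 -> {for t, continuous (fun t => G (t + c))}.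
    by move=> /dGc[+ _]; move=> /derivable1_diffP; exact: differentiable_continuous.
  rewrite (@continuous_FTC2 _ (fun t => g (t + c)) (fun t => G (t + c))); [|lra| | | ].
  - rewrite -EFinB lee_fin.
    have h1 : G (1 + c) <= G 2 by apply: incr; lra.
    have h2 : G (-2) <= G (-1 + c) by apply: incr; lra.
    lra.
  - exact: continuous_subspaceT.
  - split.
    + by move=> t; rewrite in_itv/= => /andP[/ltW t1 /ltW t2]; have [|//] := dGc t; rewrite t1 t2.
    + by apply: cvg_at_right_filter; apply: dc; rewrite lexx; lra.
    + by apply: cvg_at_left_filter; apply: dc; rewrite lexx andbT; lra.
  - move=> t; rewrite in_itv/= => /andP[/ltW t1 /ltW t2].
    by rewrite derive1E; have [|_ ->//] := dGc t; rewrite t1 t2.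
have mg (c : R) : measurable_fun setT (fun t : R => g (t + c)).
  apply: (measurableT_comp (continuous_measurable_fun cg)).
  exact: measurable_funD.
rewrite (_ : (\int[_]_t _)%E =
    (\int[lebesgue_measure]_(t in `[(-1)%R, 1%R]) (decay2 k p q L `| `|s| - `|t| |%R)%:E)%E); last first.
  rewrite [RHS]integral_mkcond; apply: eq_integral => t _.
  by rewrite patchE indicE; case: (t \in _); rewrite ?mul1r ?mul0r.
apply: (@le_trans _ _ (\int[lebesgue_measure]_(t in `[(-1)%R, 1%R])
   ((g (t + s)%R)%:E + (g (t + - s)%R)%:E))%E).
  apply: ge0_le_integral => //.
  - by move=> t _; rewrite lee_fin decay2_ge0.
  - apply/measurable_EFinP; apply: measurable_funTS.
    apply: (measurableT_comp (continuous_measurable_fun (@continuous_decay2 _ k p q L))).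
    apply: measurableT_comp => //; exact: measurable_funB.
  - apply: emeasurable_funD; apply/measurable_EFinP.
      exact: (measurable_funTS (mg s)).
    exact: (measurable_funTS (mg (- s))).
  - move=> t _; rewrite -EFinD lee_fin /g.
    (* Equal signs give |t - s|, opposite signs |t + s|; the sum of both terms majorizes either
       case. *)
    have [] : `| `|s| - `|t| | = `|t + s| \/ `| `|s| - `|t| | = `|t + - s|.
      have [s0|s0] := leP 0 s; have [t0|t0] := leP 0 t;
        rewrite ?(ger0_norm s0) ?(ger0_norm t0) ?(ltr0_norm s0) ?(ltr0_norm t0).
      - by right; rewrite distrC.
      - by left; rewrite opprK addrC.
      - by left; rewrite -normrN opprB opprK.
      - by right; rewrite opprK addrC.
    + by move=> ->; rewrite lerDl; exact: decay2_ge0.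
    + by move=> ->; rewrite lerDr; exact: decay2_ge0.
rewrite ge0_integralD//; last 4 first.
- by move=> t _; rewrite lee_fin.
- by apply/measurable_EFinP; exact: (measurable_funTS (mg s)).
- by move=> t _; rewrite lee_fin.
- by apply/measurable_EFinP; exact: (measurable_funTS (mg (- s))).
have sN : -1 <= - s <= 1 by move: s1 => /andP[? ?]; apply/andP; split; lra.
apply: (le_trans (leeD (shift s s1) (shift (- s) sN))).
rewrite -EFinD lee_fin le_eqVlt /B; apply/orP; left; apply/eqP; ring.
Qed.

Lemma wave_L2_bounded (R : realType) (k p q : nat) (b : R * R * R -> R) :
  (0 < p)%N -> (p < q)%N -> (q < k)%N ->
  classC 2 b -> (forall w, outside_cube w -> b w = 0) ->
  exists2 C : R, 0 < C & forall L f1 f2 : R, expR 1 <= L ->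
    L2_bounded (@lebesgue_measure R \x @lebesgue_measure R)%E (@lebesgue_measure R)
      (wave k p q b L f1 f2)
      (C * (L `^ (- rho_star R k p q)) ^+ 2 * ln L ^+ log_power R k p q).
Proof.
move=> p0 pq qk Cb b0.
have [K K0 hK] := wave_kernel_bound p0 pq qk Cb b0.
have [C C0 hC] := @decay2_integral R k p q p0 pq qk.
have cb : continuous b by case: Cb.
have [M M0 bM] := bounded_on_cube 1 cb.
exists (K * C); first exact: mulr_gt0.
move=> L f1 f2 Le.
have L0 : 0 <= L by rewrite (le_trans _ Le)// expR_ge0.
have L1 : 1 <= L by apply: le_trans Le; rewrite -[leLHS]expR0 ler_expR.
have lnL : 0 <= ln L by exact: ln_ge0.
pose I (t : R) : R := \1_(`[-1, 1]) t.
have I01 x : (I x = 1 /\ -1 <= x <= 1) \/ I x = 0 /\ ~ (-1 <= x <= 1).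
  rewrite /I indicE; case: (boolP (x \in _)) => [|xI].
    by rewrite inE /= in_itv/=; left.
  by right; split => //; move/negP: xI => xI x1; apply: xI; rewrite inE /= in_itv.
have I0 x : 0 <= I x by have [[->]|[->]] := I01 x.
(* The cutoffs record that the kernel vanishes unless [s] and [t] lie in [-1, 1], the range on which
   the decay estimate and its integral are available. *)
pose N (z : R * R) : R := K * (I z.1 * (I z.2 * decay2 k p q L `| `|z.1| - `|z.2| |)).
have mI : measurable (`[-1, 1] : set (measurableTypeR R)) by exact: measurable_itv.
have fI : (lebesgue_measure (`[(-1)%R, 1%R] : set (measurableTypeR R)) < +oo)%E.
  by rewrite lebesgue_measure_itv/=; case: ifP => _; rewrite -?EFinB ltry.
have mIf : measurable_fun setT I by exact: measurable_indic.
pose D : set (measurableTypeR R * measurableTypeR R) := `[-1, 1] `*` `[-1, 1].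
apply: (@L2_bounded_TTstar _ _ _ _ R
  (sigma_finite_product (@lebesgue_measure R) (@lebesgue_measure R)) (@lebesgue_measure R)
  D `[-1, 1] (wave k p q b L f1 f2) M _ N) => //.
- exact: measurableX.
- have -> : (sigma_finite_product (@lebesgue_measure R) (@lebesgue_measure R) D =
      lebesgue_measure (`[(-1)%R, 1%R] : set (measurableTypeR R)) *
      lebesgue_measure (`[(-1)%R, 1%R] : set (measurableTypeR R)))%E.
    exact: product_measure1E.
  by rewrite lte_mul_pinfty// ge0_fin_numE.
- exact: (continuous_measurable3 (@continuous_wave R k p q b L f1 f2 cb)).
- exact: ltW.
- by rewrite mulr_ge0 ?exprn_ge0// mulr_ge0 ?sqr_ge0// mulr_ge0// ltW.
- move=> [x y] t; rewrite -/(I t).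
  have -> : (\1_D (x, y) : R) = I x * I y.
    by rewrite /I !indicE in_setX /= -natrM mulnb.
  have w0 : b (x, y, t) = 0 -> `|wave k p q b L f1 f2 (x, y, t)| = 0.
    by rewrite /wave => ->; rewrite mulr0 normr0.
  have [[-> x1]|[-> x1]] := I01 x; last by rewrite !mul0r mulr0 w0// b0// => -[].
  have [[-> y1]|[-> y1]] := I01 y; last by rewrite mulr0 mul0r mulr0 w0// b0// => -[].
  have [[-> t1]|[-> t1]] := I01 t; last by rewrite !mulr0 w0// b0// => -[].
  rewrite !mulr1 (le_trans _ (bM x y t x1 y1 t1))//.
  by rewrite /wave !normrM ler_piMl// mulr_ile1// ler_norml cos_geN1 cos_le1.
- apply: measurable_funM => //; apply: measurable_funM; first exact: measurableT_comp.
  apply: measurable_funM; first exact: measurableT_comp.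
  apply: (measurableT_comp (continuous_measurable_fun (@continuous_decay2 _ k p q L))).
  apply: measurableT_comp => //; apply: measurable_funB.
    by apply: measurableT_comp => //; exact: measurable_fst.
  by apply: measurableT_comp => //; exact: measurable_snd.
- move=> s t; apply: mulr_ge0; first exact: ltW.
  by apply: mulr_ge0 => //; apply: mulr_ge0 => //; exact: decay2_ge0.
- by move=> s t; rewrite /N /= distrC (mulrCA (I s)).
- move=> s t; rewrite /N /=.
  have w0 u : ~ (-1 <= u <= 1) -> forall z, wave k p q b L f1 f2 (z, u) = 0.
    by move=> u1 z; rewrite /wave b0 ?mulr0// => -[].
  have [[-> s1]|[-> s1]] := I01 s; last first.
    under eq_Rintegral do rewrite w0// mul0r.
    by rewrite /Rintegral integral0 /= normr0 !(mul0r, mulr0).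
  have [[-> t1]|[-> t1]] := I01 t; last first.
    under eq_Rintegral do rewrite (w0 t)// mulr0.
    by rewrite /Rintegral integral0 /= normr0 !(mul0r, mulr0).
  by rewrite !mul1r; exact: hK.
- move=> s; have [[Is s1]|[Is s1]] := I01 s; last first.
    under eq_integral do rewrite /N /= Is mul0r mulr0.
    by rewrite integral0 lee_fin mulr_ge0 ?exprn_ge0// mulr_ge0 ?sqr_ge0// mulr_ge0// ltW.
  under eq_integral do rewrite /N /= Is mul1r EFinM.
  rewrite ge0_integralZl//; first last.
  + by rewrite lee_fin ltW.
  + by move=> t _; rewrite lee_fin; apply: mulr_ge0 => //; exact: decay2_ge0.
  + apply/measurable_EFinP; apply: measurable_funM => //.
    apply: (measurableT_comp (continuous_measurable_fun (@continuous_decay2 _ k p q L))).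
    by apply: measurableT_comp => //; exact: measurable_funB.
  rewrite -(mulrA K C) -(mulrA K) EFinM; apply: lee_wpmul2l; first by rewrite lee_fin ltW.
  exact: hC.
Qed.

(** * The operator with complex amplitude *)

Local Open Scope complex_scope.

Definition phase_re {R : realType} (k p q : nat) (a : R * R * R -> R[i]) (L : R)
    (w : R * R * R) : R :=
  complex.Re (cis (L * Phi k p q w.1.1 w.1.2 w.2) * a w).

Definition phase_im {R : realType} (k p q : nat) (a : R * R * R -> R[i]) (L : R)
    (w : R * R * R) : R :=
  complex.Im (cis (L * Phi k p q w.1.1 w.1.2 w.2) * a w).

(* Shifting a phase by [pi / 2] turns cosines into sines and absorbs signs. *)
Lemma phase_reE (R : realType) (k p q : nat) (a : R * R * R -> R[i]) (L : R) :
  phase_re k p q a L = fun w =>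
   (wave k p q (fun w => complex.Re (a w)) L 0 0 w +
    wave k p q (fun w => complex.Re (a w)) L (pi / 2) (- (pi / 2)) w) +
   (wave k p q (fun w => complex.Im (a w)) L (pi / 2) 0 w +
    wave k p q (fun w => complex.Im (a w)) L 0 (pi / 2) w).
Proof.
apply/funext => w; rewrite /phase_re /wave /cis /Phi; case: (a w) => u v /=.
rewrite !addr0 !cosDpihalf cosBpihalf.
have -> : L * (w.1.1 ^+ (k - p) * w.2 ^+ p + w.1.2 ^+ (k - q) * w.2 ^+ q) =
  L * w.2 ^+ p * w.1.1 ^+ (k - p) + L * w.2 ^+ q * w.1.2 ^+ (k - q) by ring.
by rewrite cosD sinD; ring.
Qed.

Lemma phase_imE (R : realType) (k p q : nat) (a : R * R * R -> R[i]) (L : R) :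
  phase_im k p q a L = fun w =>
   (wave k p q (fun w => complex.Im (a w)) L 0 0 w +
    wave k p q (fun w => complex.Im (a w)) L (pi / 2) (- (pi / 2)) w) +
   (wave k p q (fun w => complex.Re (a w)) L (- (pi / 2)) 0 w +
    wave k p q (fun w => complex.Re (a w)) L 0 (- (pi / 2)) w).
Proof.
apply/funext => w; rewrite /phase_im /wave /cis /Phi; case: (a w) => u v /=.
rewrite !addr0 !cosDpihalf !cosBpihalf.
have -> : L * (w.1.1 ^+ (k - p) * w.2 ^+ p + w.1.2 ^+ (k - q) * w.2 ^+ q) =
  L * w.2 ^+ p * w.1.1 ^+ (k - p) + L * w.2 ^+ q * w.1.2 ^+ (k - q) by ring.
by rewrite cosD sinD; ring.
Qed.

Lemma test_function_outside (R : realType) (a : R * R * R -> R[i]) :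
  supp a `<=` (`[-1, 1] `*` `[-1, 1]) `*` `[-1, 1] ->
  forall w, outside_cube w -> a w = 0.
Proof.
move=> sa w ow; apply/eqP; apply: contrapT => /negP aw.
have /sa : supp a w by exact: subset_closure.
by move=> [[/= h1 h2] h3]; apply: ow; move: h1 h2 h3; rewrite !in_itv.
Qed.

Lemma phase_L2_bounded (R : realType) (k p q : nat) (a : R * R * R -> R[i]) :
  (0 < p)%N -> (p < q)%N -> (q < k)%N -> test_function a ->
  supp a `<=` (`[-1, 1] `*` `[-1, 1]) `*` `[-1, 1] ->
  exists2 C : R, 0 < C & forall L : R, expR 1 <= L ->
    let A := C * (L `^ (- rho_star R k p q)) ^+ 2 * ln L ^+ log_power R k p q in
    L2_bounded (@lebesgue_measure R \x @lebesgue_measure R)%E (@lebesgue_measure R)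
      (phase_re k p q a L) A /\
    L2_bounded (@lebesgue_measure R \x @lebesgue_measure R)%E (@lebesgue_measure R)
      (phase_im k p q a L) A.
Proof.
move=> p0 pq qk [sre sim _] sa.
have a0 := test_function_outside sa.
have [C1 C10 h1] := @wave_L2_bounded R k p q _ p0 pq qk (sre 2%N)
  (fun w ow => congr1 (@complex.Re R) (a0 w ow)).
have [C2 C20 h2] := @wave_L2_bounded R k p q _ p0 pq qk (sim 2%N)
  (fun w ow => congr1 (@complex.Im R) (a0 w ow)).
(* Four waves are added in two rounds, each round costing a factor 2: 2 (2 (C1 + C1) + 2 (C2 +
   C2)). *)
exists (8 * (C1 + C2)); first by rewrite mulr_gt0// addr_gt0.
move=> L Le A; rewrite phase_reE phase_imE.
have E1 : A = 2 * (2 * (C1 * (L `^ (- rho_star R k p q)) ^+ 2 * ln L ^+ log_power R k p q +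
   C1 * (L `^ (- rho_star R k p q)) ^+ 2 * ln L ^+ log_power R k p q) +
   2 * (C2 * (L `^ (- rho_star R k p q)) ^+ 2 * ln L ^+ log_power R k p q +
   C2 * (L `^ (- rho_star R k p q)) ^+ 2 * ln L ^+ log_power R k p q)) by rewrite /A; ring.
have E2 : A = 2 * (2 * (C2 * (L `^ (- rho_star R k p q)) ^+ 2 * ln L ^+ log_power R k p q +
   C2 * (L `^ (- rho_star R k p q)) ^+ 2 * ln L ^+ log_power R k p q) +
   2 * (C1 * (L `^ (- rho_star R k p q)) ^+ 2 * ln L ^+ log_power R k p q +
   C1 * (L `^ (- rho_star R k p q)) ^+ 2 * ln L ^+ log_power R k p q)) by rewrite /A; ring.
split.
- rewrite E1; apply: L2_boundedD; first exact: L2_boundedD (h1 _ _ _ Le) (h1 _ _ _ Le).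
  exact: L2_boundedD (h2 _ _ _ Le) (h2 _ _ _ Le).
- rewrite E2; apply: L2_boundedD; first exact: L2_boundedD (h2 _ _ _ Le) (h2 _ _ _ Le).
  exact: L2_boundedD (h1 _ _ _ Le) (h1 _ _ _ Le).
Qed.

Local Close Scope complex_scope.

(** Trades the root in the norm for an integral of squares; nonnegativity of [B] makes the squaring
    reversible. *)
Lemma L2norm_le (d : measure_display) (T : measurableType d) (R : realType)
    (mu : {measure set T -> \bar R}) (f : T -> R[i]) (B : R) : 0 <= B ->
  ((L2norm mu f <= B%:E)%E <->
   (\int[mu]_x (complex.Re (f x) ^+ 2 + complex.Im (f x) ^+ 2)%:E <= (B ^+ 2)%:E)%E).
Proof.
move=> B0.
have IE : (\int[mu]_x (complex.Re (f x) ^+ 2 + complex.Im (f x) ^+ 2)%:E =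
    (L2norm mu f) `^ 2)%E.
  rewrite /L2norm powR_Lnorm//; apply: eq_integral => x _.
  case: (f x) => u v /=; rewrite powR_mulrn// ger0_norm ?sqrtr_ge0//.
  by rewrite sqr_sqrtr// addr_ge0// sqr_ge0.
have N0 : (0 <= L2norm mu f)%E by exact: Lnorm_ge0.
rewrite IE; have -> : (B ^+ 2)%:E = (B%:E `^ 2)%E by rewrite poweR_EFin powR_mulrn.
have nn (x : \bar R) : (0 <= x)%E -> x \in `[0%E, +oo%E] by move=> x0; rewrite in_itv/= x0 leey.
split => h.
  by apply: gt0_ler_poweR => //; exact: nn.
have h2 : ((L2norm mu f `^ 2) `^ 2^-1 <= (B%:E `^ 2) `^ 2^-1)%E.
  by apply: gt0_ler_poweR => //; apply: nn; exact: poweR_ge0.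
by rewrite -!poweRrM mulfV// !poweRe1 in h2.
Qed.

Unset Implicit Arguments.
Set Strict Implicit.

Theorem theorem1p2 (R : realType) (k kP kQ : nat) (a : R * R * R -> R[i])
    (hk : (3 <= k)%N) (hP : (1 <= kP)%N) (hPQ : (kP < kQ)%N) (hQ : (kQ < k)%N)
    (ha : test_function a)
    (hsupp : supp a `<=` (`[-1, 1] `*` `[-1, 1]) `*` `[-1, 1]) :
  exists2 C : R, 0 < C &
    \forall lam \near +oo%R,
      (opnorm (@lebesgue_measure R)
              ((@lebesgue_measure R) \x (@lebesgue_measure R))%E
              (Tlam k kP kQ a lam)
       <= (C * lam `^ (- rho_star R k kP kQ) * ln lam ^+ log_power R k kP kQ)%:E)%E.
Proof.
(* Origin of [4 * C + 1]: its square dominates [4 * C], and [y <= y ^+ 2] because [y >= 1]. Here a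
   full power of the logarithm is accepted in place of its square root. *)
have constants (c x y : R) : 0 < c -> 0 <= x -> 1 <= y ->
    4 * (c * x ^+ 2 * y) <= ((4 * c + 1) * x * y) ^+ 2.
  move=> c0 x0 y1.
  have cc : 0 <= c * c by rewrite mulr_ge0// ltW.
  have -> : ((4 * c + 1) * x * y) ^+ 2 = (4 * c + 1) ^+ 2 * x ^+ 2 * (y * y) by ring.
  have -> : 4 * (c * x ^+ 2 * y) = (4 * c) * x ^+ 2 * y by ring.
  apply: ler_pM; [by rewrite mulr_ge0 ?sqr_ge0//; lra|lra| |by rewrite ler_peMl//; lra].
  by rewrite ler_wpM2r ?sqr_ge0// expr2; lra.
have squares (s1 s2 s3 s4 : R) : (s1 - s2) ^+ 2 + (s3 + s4) ^+ 2 <=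
    2 * s1 ^+ 2 + 2 * s2 ^+ 2 + (2 * s3 ^+ 2 + 2 * s4 ^+ 2).
  by have := sqr_ge0 (s1 + s2); have := sqr_ge0 (s3 - s4); lra.
have [C C0 hC] := phase_L2_bounded hP hPQ hQ ha hsupp.
exists (4 * C + 1); first by rewrite addr_gt0// mulr_gt0.
near=> lam.
have lamE : expR 1 <= lam by near: lam; apply: nbhs_pinfty_ge; rewrite num_real.
have lam1 : 1 <= lam by apply: le_trans lamE; rewrite -[leLHS]expR0 ler_expR.
have lnl : 1 <= ln lam by rewrite -[leLHS](expRK 1) ler_ln// posrE ?expR_gt0//; lra.
have := hC lam lamE; set x := lam `^ _; set y := ln lam ^+ _ => /= -[bre bim].
have x0 : 0 <= x by exact: powR_ge0.
have y1 : 1 <= y by exact: exprn_ege1.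
have B0 : 0 <= (4 * C + 1) * x * y by rewrite !mulr_ge0//; lra.
rewrite /opnorm; apply: ub_ereal_sup => _ [f [[mre mim _] f1] <-].
apply/(L2norm_le _ _ B0).
have /(L2norm_le _ _ ler01) := f1; rewrite expr1n => fle.
set fr := fun t => complex.Re (f t) in mre fle; set fi := fun t => complex.Im (f t) in mim fle.
have mre2 : measurable_fun setT (fun t => (fr t ^+ 2)%:E).
  by apply/measurable_EFinP; exact: measurable_funX.
have mim2 : measurable_fun setT (fun t => (fi t ^+ 2)%:E).
  by apply/measurable_EFinP; exact: measurable_funX.
have sq0 (h : R -> R) t : setT t -> (0 <= (h t ^+ 2)%:E)%E by rewrite lee_fin sqr_ge0.
have fle' : (\int[lebesgue_measure]_t (fr t ^+ 2)%:E +
    \int[lebesgue_measure]_t (fi t ^+ 2)%:E <= 1)%E.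
  by rewrite -ge0_integralD//; exact: sq0.
set Ir := (\int[lebesgue_measure]_t (fr t ^+ 2)%:E)%E in fle'.
set Ii := (\int[lebesgue_measure]_t (fi t ^+ 2)%:E)%E in fle'.
have Ir0 : (0 <= Ir)%E by apply: integral_ge0; exact: sq0.
have Ii0 : (0 <= Ii)%E by apply: integral_ge0; exact: sq0.
have Iry : (Ir < +oo)%E by apply: le_lt_trans (ltry 1); apply: le_trans fle'; rewrite leeDl.
have Iiy : (Ii < +oo)%E by apply: le_lt_trans (ltry 1); apply: le_trans fle'; rewrite leeDr.
(* Complex multiplication mixes the parts: re fr - im fi is the real part and re fi + im fr the
   imaginary one, hence four real operators. *)
have [i1 m1 l1] := bre fr mre Iry; have [i2 m2 l2] := bim fi mim Iiy.
have [i3 m3 l3] := bre fi mim Iiy; have [i4 m4 l4] := bim fr mre Iry.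
set S1 := (fun z => \int[_]_t _) in m1; set S2 := (fun z => \int[_]_t _) in m2.
set S3 := (fun z => \int[_]_t _) in m3; set S4 := (fun z => \int[_]_t _) in m4.
have TR z : complex.Re (Tlam k kP kQ a lam f z) = S1 z - S2 z.
  rewrite /Tlam /cintegral /= -RintegralB//; apply: eq_Rintegral => t _.
  by rewrite /phase_re /phase_im /fr /fi /=; case: (cis _ * _) => u v; case: (f t).
have TI z : complex.Im (Tlam k kP kQ a lam f z) = S3 z + S4 z.
  rewrite /Tlam /cintegral /= -RintegralD//; apply: eq_Rintegral => t _.
  by rewrite /phase_re /phase_im /fr /fi /=; case: (cis _ * _) => u v; case: (f t).
have mX (S : R * R -> R) : measurable_fun setT S ->
    measurable_fun setT (fun z => (2 * S z ^+ 2)%:E).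
  move=> mS; apply/measurable_EFinP; apply: measurable_funM => //; exact: measurable_funX.
have X0 (S : R * R -> R) z : (0 <= (2 * S z ^+ 2)%:E)%E by rewrite lee_fin mulr_ge0// sqr_ge0.
set nu := (_ \x _)%E.
apply: (@le_trans _ _ (\int[nu]_z (((2 * S1 z ^+ 2)%:E + (2 * S2 z ^+ 2)%:E) +
   ((2 * S3 z ^+ 2)%:E + (2 * S4 z ^+ 2)%:E)))%E).
  apply: ge0_le_integral => //.
  - by move=> z _; rewrite lee_fin addr_ge0// sqr_ge0.
  - apply/measurable_EFinP; apply: measurable_funD; apply: measurable_funX.
      by under eq_fun do rewrite TR; exact: measurable_funB.
    by under eq_fun do rewrite TI; exact: measurable_funD.
  - by apply: emeasurable_funD; apply: emeasurable_funD; exact: mX.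
  - by move=> z _; rewrite TR TI -!EFinD lee_fin; exact: squares.
rewrite ge0_integralD//; last 4 first.
- by move=> z _; rewrite adde_ge0.
- by apply: emeasurable_funD; exact: mX.
- by move=> z _; rewrite adde_ge0.
- by apply: emeasurable_funD; exact: mX.
rewrite !ge0_integralD//; try exact: mX; try by move=> z _; exact: X0.
have I2 (S : R * R -> R) (I : \bar R) : measurable_fun setT S ->
    (\int[nu]_z (S z ^+ 2)%:E <= (C * x ^+ 2 * y)%:E * I)%E ->
    (\int[nu]_z (2 * S z ^+ 2)%:E <= 2%:E * ((C * x ^+ 2 * y)%:E * I))%E.
  move=> mS lI; under eq_integral do rewrite EFinM.
  rewrite ge0_integralZl//; first by apply: lee_wpmul2l.
    by apply/measurable_EFinP; exact: measurable_funX.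
  by move=> z _; rewrite lee_fin sqr_ge0.
apply: (le_trans (leeD (leeD (I2 _ _ m1 l1) (I2 _ _ m2 l2)) (leeD (I2 _ _ m3 l3) (I2 _ _ m4 l4)))).
have fIr : Ir \is a fin_num by rewrite ge0_fin_numE.
have fIi : Ii \is a fin_num by rewrite ge0_fin_numE.
move: fle'; rewrite -/Ir -/Ii -(fineK fIr) -(fineK fIi) -!EFinM -!EFinD !lee_fin.
set u := fine Ir; set v := fine Ii => uv.
have Z0 : 0 <= C * x ^+ 2 * y by rewrite !mulr_ge0 ?sqr_ge0 ?(ltW C0) ?(le_trans ler01 y1).
(* The four terms add up to 4 C x^2 y (u + v), and u + v <= 1 by the normalization of [f]. *)
apply: (le_trans _ (constants C x y C0 x0 y1)).
have -> : 2 * (C * x ^+ 2 * y * u) + 2 * (C * x ^+ 2 * y * v) +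
  (2 * (C * x ^+ 2 * y * v) + 2 * (C * x ^+ 2 * y * u)) = 4 * (C * x ^+ 2 * y) * (u + v) by ring.
by rewrite ler_piMr// mulr_ge0.
Unshelve. all: by end_near. Qed.
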